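(* Let $n\in\mathbb{N}$. There is an equivalence of categories $$Pol_n(gr,Ab)\simeq (PMack(\Omega(\mathcal{A}s),Ab))_{\le n}$$ between the category of reduced polynomial functors of degree $n$ (i.e. lower or equal to $n$) from finitely generated free groups to abelian groups and the full subcategory $(PMack(\Omega(\mathcal{A}s),Ab))_{\le n}$ of $PMack(\Omega(\mathcal{A}s),Ab)$ whose objects are the pseudo-Mackey functors which vanish on $\underline{0}$ and on the sets $\underline{m}$ with $m>n$.
   Context: Polynomial functors. $gr$ is the category of finitely generated free groups, a pointed category with finite coproducts $\vee$ (free product). A functor $F:gr\to Ab$ is reduced if $F(0)=0$. For $m\ge1$ its $m$-th cross-effect is $cr_mF(X_1,\dots,X_m)=\ker\big(F(X_1\vee\cdots\vee X_m)\to\bigoplus_{k=1}^mF(X_1\vee\cdots\vee\widehat{X_k}\vee\cdots\vee X_m)\big)$, the components being induced by the retractions killing the $k$-th summand. $F$ is polynomial of degree lower or equal to $n$ if $cr_{n+1}F=0$. $Pol_n(gr,Ab)$ is the category of reduced polynomial functors $gr\to Ab$ of degree lower or equal to $n$ and natural transformations. The category $\Omega(\mathcal{A}s)$ ($\mathcal{A}s$ being the unitary associative set-operad, $\mathcal{A}s(n)=\mathfrak{S}_n$). Objects: the sets $\underline{n}=\{1,\dots,n\}$, $n\ge0$. A morphism $\underline{n}\to\underline{m}$ is a surjection $f:\underline n\to\underline m$ together with a total ordering of each fibre $f^{-1}(j)$, $j\in\underline{m}$. The composite of $f:\underline n\to\underline m$ and $g:\underline m\to\underline k$ is $g\circ f$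 with $(g\circ f)^{-1}(i)=\coprod_{j\in g^{-1}(i)}f^{-1}(j)$ ordered as the ordered union of ordered sets (indexed by the ordered set $g^{-1}(i)$). $\Omega$ is the category of the sets $\underline{n}$ and surjections. The double category $\Omega(\mathcal{A}s)_2$. Horizontal arrows are morphisms of $\Omega$, vertical arrows are morphisms of $\Omega(\mathcal{A}s)$. A square $\mathcal{D}$ consists of horizontal $f:A\to B$, $g:C\to D$ and vertical $\phi:A\to C$, $\psi:B\to D$ such that the underlying diagram of sets $\psi f=g\phi$ is a pullback and for all $c\in C$ the bijection $\phi^{-1}(c)\to\psi^{-1}(g(c))$ induced by $f$ is an isomorphism of ordered sets. Given $g$ and $\psi$ with common target such a square exists and is unique up to isomorphism. A double isomorphism is a pair $(f,u)$ where $f:A\to A$ is a bijection and $u$ is $f$ viewed as a morphism of $\Omega(\mathcal{A}s)$. For $A'\subset A$ (identified with $\underline{|A'|}$ by the order-preserving bijection), $f_{A'}$ is the restriction of $f$ and $\phi_{A'}$ is the restriction of $\phi$ with fibres carrying the restricted orders; $A'$ is $\mathcal{D}$-admissible if $f_{A'}$ and $\phi_{A'}$ are surjective, and $Adm(\mathcal{D})$ is the set of $\mathcal{D}$-admissible subsets. Pseudo-Mackey functors. A Janus functor $M:\Omega(\mathcal{A}s)_2\to Ab$ is a pair of functors $M_*:\Omega\to Ab$, $M^*:\Omega(\mathcal{A}s)^{op}\to Ab$ agreeing on objects. It is a pseudo-Mackey functor if (1) $M_*(f)M^*(u)=\mathrm{Id}$ for every double isomorphism $(f,u)$; (2) for every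 square $\mathcal{D}$ in $\Omega(\mathcal{A}s)_2$ with horizontal arrows $f:A\to B$, $g:C\to D$ and vertical arrows $\phi:A\to C$, $\psi:B\to D$, $M^*(\psi)M_*(g)=\sum_{A'\in Adm(\mathcal{D})}M_*(f_{A'})M^*(\phi_{A'})$. $PMack(\Omega(\mathcal{A}s),Ab)$ is the category of these; morphisms are families of homomorphisms $M(A)\to N(A)$ natural for both $M_*$ and $M^*$. *)

(* Defs.v *)
From HB Require Import structures.
From mathcomp Require Import all_boot all_order all_algebra.
From mathcomp Require Import monoid boolp.
Set Implicit Arguments.
Unset Strict Implicit.
Unset Printing Implicit Defensive.
Import GRing.Theory.
Import Algebra.
Local Open Scope group_scope.
Local Open Scope quotient_scope.

Record category := Category {
  ob :> Type;
  hom : ob -> ob -> Type;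
  idm : forall x, hom x x;
  cmp : forall x y z, hom y z -> hom x y -> hom x z;
  cmp1m : forall x y (f : hom x y), cmp (idm y) f = f;
  cmpm1 : forall x y (f : hom x y), cmp f (idm x) = f;
  cmpA : forall x y z t (h : hom z t) (g : hom y z) (f : hom x y),
    cmp h (cmp g f) = cmp (cmp h g) f }.

Arguments hom {c} _ _.
Arguments idm {c} x.
Arguments cmp {c x y z} _ _.

Definition op (C : category) : category :=
  @Category C (fun x y => hom y x) (fun x => idm x) (fun x y z g f => cmp f g)
    (fun x y f => cmpm1 f) (fun x y f => cmp1m f)
    (fun x y z t h g f => esym (cmpA f g h)).

Definition full_subcat (C : category) (P : C -> Prop) : category :=
  @Category {x : C | P x} (fun x y => hom (sval x) (sval y))
    (fun x => idm (sval x)) (fun x y z g f => cmp g f)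
    (fun x y f => cmp1m f) (fun x y f => cmpm1 f)
    (fun x y z t h g f => cmpA h g f).

Record functor_on (C D : category) (F : C -> D) := FunctorOn {
  fmap : forall x y, hom x y -> hom (F x) (F y);
  fmap1 : forall x, fmap (idm x) = idm (F x);
  fmapM : forall x y z (g : hom y z) (f : hom x y),
    fmap (cmp g f) = cmp (fmap g) (fmap f) }.

Arguments fmap {C D F} _ {x y} _.

Record functor (C D : category) := Functor {
  fob :> C -> D;
  fmor :> functor_on fob }.

Arguments fmor {C D} _.

Definition functor_id (C : category) : functor C C :=
  @Functor C C id (@FunctorOn C C id (fun x y f => f)
    (fun x => erefl) (fun x y z g f => erefl)).

Lemma functor_comp1 (C D E : category) (G : functor D E) (F : functor C D) x :
  fmap G (fmap F (idm x)) = idm (G (F x)).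
Proof. by rewrite !fmap1. Qed.

Lemma functor_compM (C D E : category) (G : functor D E) (F : functor C D)
    x y z (g : hom y z) (f : hom x y) :
  fmap G (fmap F (cmp g f)) = cmp (fmap G (fmap F g)) (fmap G (fmap F f)).
Proof. by rewrite !fmapM. Qed.

Definition functor_comp (C D E : category) (G : functor D E) (F : functor C D) :
    functor C E :=
  Functor (FunctorOn (functor_comp1 G F) (functor_compM G F)).

Record nat_trans (C D : category) (F G : functor C D) := NatTrans {
  nt :> forall x, hom (F x) (G x);
  ntN : forall x y (f : hom x y), cmp (nt y) (fmap F f) = cmp (fmap G f) (nt x) }.

Lemma nat_trans_eq (C D : category) (F G : functor C D) (a b : nat_trans F G) :
  (forall x, a x = b x) -> a = b.
Proof.
case: a b => [a aN] [b bN] /= eab; have {}eab : a = b by apply: functional_extensionality_dep.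
by case: _ / eab in bN *; rewrite (Prop_irrelevance aN bN).
Qed.

Section FunctorCategory.
Variables C D : category.

Lemma nat_id_subproof (F : functor C D) x y (f : hom x y) :
  cmp (idm (F y)) (fmap F f) = cmp (fmap F f) (idm (F x)).
Proof. by rewrite cmp1m cmpm1. Qed.

Definition nat_id F := NatTrans (@nat_id_subproof F).

Lemma nat_comp_subproof (F G H : functor C D) (b : nat_trans G H)
    (a : nat_trans F G) x y (f : hom x y) :
  cmp (cmp (b y) (a y)) (fmap F f) = cmp (fmap H f) (cmp (b x) (a x)).
Proof. by rewrite -cmpA ntN cmpA ntN cmpA. Qed.

Definition nat_comp F G H b a := NatTrans (@nat_comp_subproof F G H b a).

Lemma nat_comp1m F G (a : nat_trans F G) : nat_comp (nat_id G) a = a.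
Proof. by apply: nat_trans_eq => x /=; rewrite cmp1m. Qed.

Lemma nat_compm1 F G (a : nat_trans F G) : nat_comp a (nat_id F) = a.
Proof. by apply: nat_trans_eq => x /=; rewrite cmpm1. Qed.

Lemma nat_compA F G H K (c : nat_trans H K) (b : nat_trans G H)
    (a : nat_trans F G) :
  nat_comp c (nat_comp b a) = nat_comp (nat_comp c b) a.
Proof. by apply: nat_trans_eq => x /=; rewrite cmpA. Qed.

Definition functor_cat : category :=
  @Category (functor C D) (@nat_trans C D) nat_id nat_comp
    nat_comp1m nat_compm1 nat_compA.

End FunctorCategory.

Definition is_iso (C : category) (x y : C) (f : hom x y) : Prop :=
  exists g : hom y x, cmp g f = idm x /\ cmp f g = idm y.

Definition isomorphic (C : category) (x y : C) : Prop :=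
  exists f : hom x y, is_iso f.

Definition equivalent_categories (C D : category) : Prop :=
  exists (F : functor C D) (G : functor D C),
    @isomorphic (functor_cat C C) (functor_id C) (functor_comp G F) /\
    @isomorphic (functor_cat D D) (functor_comp F G) (functor_id D).

Lemma additive_eq (U V : zmodType) (f g : {additive U -> V}) :
  (f : U -> V) =1 g -> f = g.
Proof.
case: f g => [f [[fP]]] [g [[gP]]] /= /funext efg.
by case: _ / efg in gP *; rewrite (Prop_irrelevance fP gP).
Qed.

Lemma ab_cmp1m (U V : zmodType) (f : {additive U -> V}) :
  (idfun \o f : {additive U -> V}) = f.
Proof. exact: additive_eq. Qed.

Lemma ab_cmpm1 (U V : zmodType) (f : {additive U -> V}) :
  (f \o idfun : {additive U -> V}) = f.
Proof. exact: additive_eq. Qed.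

Lemma ab_cmpA (U V W X : zmodType) (h : {additive W -> X})
    (g : {additive V -> W}) (f : {additive U -> V}) :
  (h \o (g \o f) : {additive U -> X}) = ((h \o g) \o f : {additive U -> X}).
Proof. exact: additive_eq. Qed.

Definition Ab : category :=
  @Category zmodType (fun U V => {additive U -> V}) (fun U => idfun)
    (fun U V W g f => (g \o f : {additive U -> W})) ab_cmp1m ab_cmpm1 ab_cmpA.

Definition ab_app (U V : Ab) (h : hom U V) : (U : zmodType) -> (V : zmodType) :=
  (h : {additive (U : zmodType) -> (V : zmodType)}).

Definition ab_zero (U : Ab) : Prop := forall x : (U : zmodType), x = 0%R.

Notation "{ 'ghom' G -> H }" := (UMagmaMorphism.type G H)
  (at level 0, G at level 98, H at level 99) : type_scope.

Lemma ghom_eq (G H : groupType) (f g : {ghom G -> H}) : (f : G -> H) =1 g -> f = g.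
Proof.
case: f g => [f [[fP] [fQ]]] [g [[gP] [gQ]]] /= /funext efg.
case: _ / efg in gP gQ *.
by rewrite (Prop_irrelevance fP gP) (Prop_irrelevance fQ gQ).
Qed.

Lemma grp_cmp1m (G H : groupType) (f : {ghom G -> H}) :
  (idfun \o f : {ghom G -> H}) = f.
Proof. exact: ghom_eq. Qed.

Lemma grp_cmpm1 (G H : groupType) (f : {ghom G -> H}) :
  (f \o idfun : {ghom G -> H}) = f.
Proof. exact: ghom_eq. Qed.

Lemma grp_cmpA (G H K L : groupType) (h : {ghom K -> L}) (g : {ghom H -> K})
    (f : {ghom G -> H}) :
  (h \o (g \o f) : {ghom G -> L}) = ((h \o g) \o f : {ghom G -> L}).
Proof. exact: ghom_eq. Qed.

Definition Grp : category :=
  @Category groupType (fun G H => {ghom G -> H}) (fun G => idfun)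
    (fun G H K g f => (g \o f : {ghom G -> K})) grp_cmp1m grp_cmpm1 grp_cmpA.

Definition fg_free (G : Grp) : Prop :=
  exists (B : finType) (b : B -> (G : groupType)),
    forall (H : groupType) (h : B -> H),
      exists! phi : {ghom (G : groupType) -> H}, forall x, phi (b x) = h x.

Definition gr : category := full_subcat fg_free.

(* The free product of a family of groups is realised as the monoid of words in
   the disjoint union of the groups, modulo the congruence identifying two words
   that take the same value under every family of morphisms to a group.  Its
   universal property is given by [fprod_caseK] and [fprod_hom_eq]. *)
Section FreeProduct.
Variables (I : finType) (X : I -> groupType).

Definition word := seq {i : I & X i}.

Definition word_eval (H : groupType) (f : forall i, {ghom X i -> H}) (w : word) : H :=
  \prod_(l <- w) f (tag l) (tagged l).

Definition word_equiv (v w : word) : bool :=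
  `[< forall (H : groupType) (f : forall i, {ghom X i -> H}),
        word_eval f v = word_eval f w >].

Lemma word_equiv_refl : reflexive word_equiv.
Proof. by move=> v; apply/asboolP. Qed.

Lemma word_equiv_sym : symmetric word_equiv.
Proof. by move=> v w; apply/asboolP/asboolP => E H f; rewrite E. Qed.

Lemma word_equiv_trans : transitive word_equiv.
Proof.
move=> v u w /asboolP E1 /asboolP E2; apply/asboolP => H f.
by rewrite E1 E2.
Qed.

Canonical word_equiv_equiv_rel :=
  EquivRel word_equiv word_equiv_refl word_equiv_sym word_equiv_trans.

Definition fprod := {eq_quot word_equiv}.

HB.instance Definition _ := Quotient.on fprod.
HB.instance Definition _ := Choice.copy fprod {eq_quot word_equiv}.

Definition fprod_eval (H : groupType) (f : forall i, {ghom X i -> H}) (a : fprod) : H :=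
  word_eval f (repr a).

Lemma fprod_eval_pi (H : groupType) (f : forall i, {ghom X i -> H}) w :
  fprod_eval f (\pi_fprod w) = word_eval f w.
Proof.
have /eqmodP /asboolP : repr (\pi_fprod w) = w %[mod fprod] by rewrite reprK.
exact.
Qed.

Lemma fprod_eval_inj (a b : fprod) :
  (forall (H : groupType) (f : forall i, {ghom X i -> H}), fprod_eval f a = fprod_eval f b) ->
  a = b.
Proof.
by move=> E; rewrite -[a]reprK -[b]reprK; apply/eqmodP/asboolP => H f; exact: E.
Qed.

Definition fprod_one : fprod := \pi_fprod [::].
Definition fprod_mul (a b : fprod) : fprod := \pi_fprod (repr a ++ repr b).
Definition fprod_inv (a : fprod) : fprod :=
  \pi_fprod (rev [seq Tagged X (tagged l)^-1 | l : {i : I & X i} <- repr a]).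

Lemma fprod_eval1 (H : groupType) (f : forall i, {ghom X i -> H}) : fprod_eval f fprod_one = 1.
Proof. by rewrite fprod_eval_pi /word_eval big_nil. Qed.

Lemma fprod_evalM (H : groupType) (f : forall i, {ghom X i -> H}) a b :
  fprod_eval f (fprod_mul a b) = fprod_eval f a * fprod_eval f b.
Proof. by rewrite fprod_eval_pi /word_eval big_cat. Qed.

Lemma fprod_evalV (H : groupType) (f : forall i, {ghom X i -> H}) a :
  fprod_eval f (fprod_inv a) = (fprod_eval f a)^-1.
Proof.
rewrite fprod_eval_pi /fprod_eval; elim: (repr a) => [|l w IHw].
  by rewrite /word_eval big_nil invg1.
rewrite /= rev_cons -cats1 /word_eval big_cat big_seq1 /= big_cons.
by rewrite -/(word_eval _ _) IHw gmulfV invgM.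
Qed.

Lemma fprod_mulA : associative fprod_mul.
Proof. by move=> a b c; apply: fprod_eval_inj => H f; rewrite !fprod_evalM mulgA. Qed.

Lemma fprod_mul1 : left_id fprod_one fprod_mul.
Proof.
by move=> a; apply: fprod_eval_inj => H f; rewrite fprod_evalM fprod_eval1 mul1g.
Qed.

Lemma fprod_mulr1 : right_id fprod_one fprod_mul.
Proof.
by move=> a; apply: fprod_eval_inj => H f; rewrite fprod_evalM fprod_eval1 mulg1.
Qed.

Lemma fprod_mulV : left_inverse fprod_one fprod_inv fprod_mul.
Proof.
move=> a; apply: fprod_eval_inj => H f.
by rewrite fprod_evalM fprod_evalV fprod_eval1 mulVg.
Qed.

Lemma fprod_mulrV : right_inverse fprod_one fprod_inv fprod_mul.
Proof.
move=> a; apply: fprod_eval_inj => H f.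
by rewrite fprod_evalM fprod_evalV fprod_eval1 mulgV.
Qed.

HB.instance Definition _ := isGroup.Build fprod
  fprod_mulA fprod_mul1 fprod_mulr1 fprod_mulV fprod_mulrV.

Definition fprod_in_fun (i : I) (x : X i) : fprod := \pi_fprod [:: Tagged X x].

Lemma fprod_eval_in (H : groupType) (f : forall i, {ghom X i -> H}) i x :
  fprod_eval f (@fprod_in_fun i x) = f i x.
Proof. by rewrite fprod_eval_pi /word_eval big_seq1. Qed.

Lemma fprod_in_morphism i : monoid.monoid_morphism (@fprod_in_fun i).
Proof.
split=> [|x y]; apply: fprod_eval_inj => H f.
  by rewrite fprod_eval_in fprod_eval1 gmulf1.
by rewrite fprod_evalM !fprod_eval_in gmulfM.
Qed.

HB.instance Definition _ i :=
  isUMagmaMorphism.Build (X i) fprod (@fprod_in_fun i) (fprod_in_morphism i).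

Definition fprod_in i : {ghom X i -> fprod} := @fprod_in_fun i.

Lemma fprod_eval_morphism (H : groupType) (f : forall i, {ghom X i -> H}) :
  monoid.monoid_morphism (fprod_eval f).
Proof. by split=> [|a b]; [exact: fprod_eval1 | exact: fprod_evalM]. Qed.

HB.instance Definition _ (H : groupType) f :=
  isUMagmaMorphism.Build fprod H (@fprod_eval H f) (fprod_eval_morphism f).

Definition fprod_case (H : groupType) (f : forall i, {ghom X i -> H}) : {ghom fprod -> H} :=
  fprod_eval f.

Lemma fprod_caseK (H : groupType) (f : forall i, {ghom X i -> H}) i x :
  fprod_case f (fprod_in i x) = f i x.
Proof. exact: fprod_eval_in. Qed.

Lemma fprod_word (a : fprod) :
  a = \prod_(l <- repr a) fprod_in (tag l) (tagged l).
Proof.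
apply: fprod_eval_inj => H f; rewrite -[LHS]/(word_eval f (repr a)).
rewrite -[RHS]/(fprod_case f _) gmulf_prod; apply: eq_bigr => l _.
by rewrite fprod_caseK.
Qed.

Lemma fprod_hom_eq (H : groupType) (f g : {ghom fprod -> H}) :
  (forall i x, f (fprod_in i x) = g (fprod_in i x)) -> f = g.
Proof.
move=> E; apply: ghom_eq => a; rewrite (fprod_word a) !gmulf_prod.
by apply: eq_bigr => l _; exact: E.
Qed.

End FreeProduct.

Lemma fprod_fg_free (I : finType) (X : I -> gr) :
  @fg_free (fprod (fun i => sval (X i) : groupType)).
Proof.
pose Y i : groupType := sval (X i).
have bX i : {B : finType & {b : B -> Y i | forall (H : groupType) (h : B -> H),
    exists! phi : {ghom Y i -> H}, forall x, phi (b x) = h x}}.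
  by have /cid [B /cid ?] := svalP (X i); exists B.
pose B i := projT1 (bX i).
pose b i : B i -> Y i := sval (projT2 (bX i)).
have bP i := svalP (projT2 (bX i)) : forall (H : groupType) (h : B i -> H),
  exists! phi : {ghom Y i -> H}, forall x, phi (b i x) = h x.
exists {i : I & B i}, (fun k => fprod_in Y (tag k) (b _ (tagged k))) => H h.
pose f i := sval (cid (bP i H (fun x => h (Tagged B x)))).
have [fh funiq] : (forall i x, f i (b i x) = h (Tagged B x)) /\
    forall i (phi : {ghom Y i -> H}),
      (forall x, phi (b i x) = h (Tagged B x)) -> f i = phi.
  by split=> i; rewrite /f; case: cid => phi [].
exists (fprod_case f); split=> [[i x]|psi psih]; first by rewrite fprod_caseK fh.
apply: fprod_hom_eq => i x; rewrite fprod_caseK.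
by rewrite (funiq i (psi \o fprod_in Y i)) // => y; exact: (psih (Tagged B y)).
Qed.

Section Coproduct.
Variables (I : finType) (X : I -> gr).

Definition vee : gr := exist fg_free _ (fprod_fg_free X).

Definition vee_in (i : I) : hom (X i) vee :=
  @fprod_in I (fun j => sval (X j) : groupType) i.

Definition vee_case (Y : gr) (f : forall i, hom (X i) Y) : hom vee Y :=
  @fprod_case I (fun j => sval (X j) : groupType) (sval Y) f.

Lemma vee_caseK (Y : gr) (f : forall i, hom (X i) Y) i :
  cmp (vee_case f) (vee_in i) = f i.
Proof. by apply: ghom_eq => x; exact: fprod_caseK. Qed.

Lemma vee_case_uniq (Y : gr) (f : forall i, hom (X i) Y) (g : hom vee Y) :
  (forall i, cmp g (vee_in i) = f i) -> g = vee_case f.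
Proof.
move=> gf; apply: fprod_hom_eq => i x.
by rewrite [RHS]fprod_caseK -gf.
Qed.

End Coproduct.

Definition gr_triv (X Y : gr) : hom X Y :=
  (@one_fun (sval X : groupType) (sval Y : groupType)
   : {ghom (sval X : groupType) -> (sval Y : groupType)}).

(* [vee_kill X k] is the retraction of the coproduct of all the [X j] onto the
   coproduct of the [X j] with [j != k]. *)
Definition vee_omit m (X : 'I_m -> gr) (k : 'I_m) : gr :=
  vee (fun j : {j : 'I_m | j != k} => X (val j)).

Definition vee_kill m (X : 'I_m -> gr) (k : 'I_m) : hom (vee X) (vee_omit X k) :=
  vee_case (fun j : 'I_m =>
    match @idP (j != k) return hom (X j) (vee_omit X k) with
    | ReflectT jk =>
        vee_in (fun i : {i : 'I_m | i != k} => X (val i)) (exist _ j jk)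
    | ReflectF _ => gr_triv (X j) (vee_omit X k)
    end).

Definition cross_effect (F : functor gr Ab) m (X : 'I_m -> gr)
    (y : (F (vee X) : zmodType)) : Prop :=
  forall k : 'I_m, ab_app (fmap (fmor F) (vee_kill X k)) y = 0%R.

Definition reduced (F : functor gr Ab) : Prop :=
  forall X : gr, (forall x : (sval X : groupType), x = 1) -> ab_zero (F X).

Definition polynomial_le (n : nat) (F : functor gr Ab) : Prop :=
  forall (X : 'I_n.+1 -> gr) (y : (F (vee X) : zmodType)),
    cross_effect y -> y = 0%R.

Definition Pol (n : nat) : category :=
  @full_subcat (functor_cat gr Ab) (fun F => reduced F /\ polynomial_le n F).

Definition surj_fun (A B : Type) (f : A -> B) : Prop := forall y, exists x, f x = y.

Record surj (n m : nat) := Surj {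
  sfun :> 'I_n -> 'I_m;
  sfunP : surj_fun sfun }.

Lemma surj_eq n m (f g : surj n m) : f =1 g -> f = g.
Proof.
case: f g => [f fP] [g gP] /= /funext efg; case: _ / efg in gP *.
by rewrite (Prop_irrelevance fP gP).
Qed.

Lemma surj_id_subproof n : surj_fun (@id 'I_n).
Proof. by move=> y; exists y. Qed.

Definition surj_id n : surj n n := Surj (@surj_id_subproof n).

Lemma surj_comp_subproof n m k (g : surj m k) (f : surj n m) : surj_fun (g \o f).
Proof.
by move=> z; have [y <-] := sfunP g z; have [x <-] := sfunP f y; exists x.
Qed.

Definition surj_comp n m k (g : surj m k) (f : surj n m) : surj n k :=
  Surj (surj_comp_subproof g f).

Lemma surj_comp1m n m (f : surj n m) : surj_comp (surj_id m) f = f.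
Proof. exact: surj_eq. Qed.

Lemma surj_compm1 n m (f : surj n m) : surj_comp f (surj_id n) = f.
Proof. exact: surj_eq. Qed.

Lemma surj_compA n m k l (h : surj k l) (g : surj m k) (f : surj n m) :
  surj_comp h (surj_comp g f) = surj_comp (surj_comp h g) f.
Proof. exact: surj_eq. Qed.

Definition Omega : category :=
  @Category nat surj surj_id surj_comp surj_comp1m surj_compm1 surj_compA.

(* The total orders of the fibres of [f] are packed in a single relation, which
   only relates elements of the same fibre. *)
Record fibre_order n m (f : 'I_n -> 'I_m) (r : rel 'I_n) : Prop := FibreOrder {
  fo_fibre : forall x y, r x y -> f x = f y;
  fo_refl : reflexive r;
  fo_anti : antisymmetric r;
  fo_trans : transitive r;
  fo_total : forall x y, f x = f y -> r x y || r y x }.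

Record osurj (n m : nat) := OSurj {
  osfun :> surj n m;
  ole : rel 'I_n;
  oleP : fibre_order osfun ole }.

Lemma osurj_eq n m (f g : osurj n m) :
  (f : 'I_n -> 'I_m) =1 g -> ole f =2 ole g -> f = g.
Proof.
case: f g => [f r rP] [g s sP] /= /surj_eq efg ers.
have {}ers : r = s by apply/funext => x; apply/funext => y; exact: ers.
case: _ / efg in sP *; case: _ / ers in sP *.
by rewrite (Prop_irrelevance rP sP).
Qed.

Lemma osurj_id_subproof n : fibre_order (surj_id n) eq_op.
Proof.
split=> [x y /eqP //|x|x y /andP[/eqP] //|y x z /eqP -> //|x y /= ->].
- exact: eqxx.
- by rewrite eqxx.
Qed.

Definition osurj_id n : osurj n n := OSurj (@osurj_id_subproof n).

(* In a fibre of [g \o f], the elements with different images under [f] are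
   ordered as their images, and those with the same image by the order of [f]. *)
Definition ole_comp n m k (g : osurj m k) (f : osurj n m) : rel 'I_n :=
  fun x y => if f x == f y then ole f x y else ole g (f x) (f y).

Lemma osurj_comp_subproof n m k (g : osurj m k) (f : osurj n m) :
  fibre_order (surj_comp g f) (ole_comp g f).
Proof.
have [f1 f2 f3 f4 f5] := oleP f; have [g1 g2 g3 g4 g5] := oleP g.
rewrite /ole_comp; split=> /=.
- by move=> x y; case: eqP => [-> //|_ /g1].
- by move=> x; rewrite eqxx.
- move=> x y; rewrite [f y == _]eq_sym; case: eqP => [_ /f3 //|ne /g3 //].
- move=> y x z; case: (f x =P f y) => [exy|nxy].
    rewrite exy; case: (f y =P f z) => _; [exact: f4 | by []].
  case: (f y =P f z) => [<-|nyz]; first by move/eqP/negPf: nxy => ->.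
  case: (f x =P f z) => [exz|_ h1 h2]; last exact: g4 h1 h2.
  by rewrite -exz => h1 h2; case: nxy; apply: g3; rewrite h1.
- move=> x y /g5; rewrite [f y == _]eq_sym.
  by case: eqP => [/f5|].
Qed.

Definition osurj_comp n m k (g : osurj m k) (f : osurj n m) : osurj n k :=
  OSurj (osurj_comp_subproof g f).

Lemma osurj_comp1m n m (f : osurj n m) : osurj_comp (osurj_id m) f = f.
Proof.
apply: osurj_eq => // x y /=; rewrite /ole_comp /=.
case: eqP => // ne; apply/esym/negP => h; apply: ne.
exact: fo_fibre (oleP f) _ _ h.
Qed.

Lemma osurj_compm1 n m (f : osurj n m) : osurj_comp f (osurj_id n) = f.
Proof.
apply: osurj_eq => // x y /=; rewrite /ole_comp /=.
by case: eqP => // ->; rewrite (fo_refl (oleP f)).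
Qed.

Lemma osurj_compA n m k l (h : osurj k l) (g : osurj m k) (f : osurj n m) :
  osurj_comp h (osurj_comp g f) = osurj_comp (osurj_comp h g) f.
Proof.
apply: osurj_eq => // x y /=; rewrite /ole_comp /= /ole_comp.
by case: (f x =P f y) => [->|_]; rewrite ?eqxx.
Qed.

Definition OmegaAs : category :=
  @Category nat osurj osurj_id osurj_comp osurj_comp1m osurj_compm1 osurj_compA.

(* The square has top [f], bottom [g], left side [phi] and right side [psi]. *)
Record square a b c d (f : surj a b) (g : surj c d) (phi : osurj a c)
    (psi : osurj b d) : Prop := Square {
  sq_comm : forall x, psi (f x) = g (phi x);
  sq_pullback : forall y z, psi y = g z -> exists! x, f x = y /\ phi x = z;
  sq_order : forall x x', phi x = phi x' -> ole phi x x' = ole psi (f x) (f x') }.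

Definition double_iso a (f : surj a a) (u : osurj a a) : Prop :=
  bijective f /\ (u : 'I_a -> 'I_a) =1 f.

(* [enum_val] enumerates a subset of ['I_a] in increasing order. *)
Definition restr a b (f : 'I_a -> 'I_b) (A : {set 'I_a}) : 'I_#|A| -> 'I_b :=
  fun i => f (enum_val i).

Arguments restr {a b} f A.

Definition admissible a b c (f : surj a b) (phi : osurj a c) (A : {set 'I_a}) : bool :=
  `[< surj_fun (restr f A) /\ surj_fun (restr phi A) >].

Section Restriction.
Variables (a b c : nat) (f : surj a b) (phi : osurj a c).
Variable A : {A : {set 'I_a} | admissible f phi A}.

Definition surj_restr : surj #|val A| b := Surj (proj1 (asboolW (valP A))).

Lemma osurj_restr_subproof :
  fibre_order (Surj (proj2 (asboolW (valP A))))
    (fun i j => ole phi (enum_val i) (enum_val j)).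
Proof.
have [h1 h2 h3 h4 h5] := oleP phi; split=> /=.
- by move=> x y; exact: h1.
- by move=> x; exact: h2.
- by move=> x y /h3 /enum_val_inj.
- by move=> y x z; exact: h4.
- by move=> x y; exact: h5.
Qed.

Definition osurj_restr : osurj #|val A| c := OSurj osurj_restr_subproof.

End Restriction.

Record janus := Janus {
  job :> nat -> zmodType;
  jlow : @functor_on Omega Ab job;
  jup : @functor_on (op OmegaAs) Ab job }.

(* [low] is M_* (covariant on [Omega]), [up] is M^* (contravariant on [OmegaAs]). *)
Definition low (M : janus) (n m : nat) (f : surj n m) : {additive M n -> M m} :=
  @fmap Omega Ab M (jlow M) n m f.

Definition up (M : janus) (n m : nat) (phi : osurj n m) : {additive M m -> M n} :=
  @fmap (op OmegaAs) Ab M (jup M) m n phi.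

Record janus_hom (M N : janus) := JanusHom {
  jfun :> forall n, {additive M n -> N n};
  jfun_low : forall n m (f : surj n m) x, jfun m (low M f x) = low N f (jfun n x);
  jfun_up : forall n m (phi : osurj n m) x,
    jfun n (up M phi x) = up N phi (jfun m x) }.

Lemma janus_hom_eq M N (s t : janus_hom M N) : (forall n, s n =1 t n) -> s = t.
Proof.
case: s t => [s s1 s2] [t t1 t2] /= E.
have {}E : s = t.
  by apply: functional_extensionality_dep => n; exact/additive_eq/E.
case: _ / E in t1 t2 *.
by rewrite (Prop_irrelevance s1 t1) (Prop_irrelevance s2 t2).
Qed.

Definition janus_id (M : janus) : janus_hom M M :=
  @JanusHom M M (fun n => idfun) (fun n m f x => erefl) (fun n m phi x => erefl).

Section JanusComp.
Variables (M N P : janus) (t : janus_hom N P) (s : janus_hom M N).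

Lemma janus_comp_low n m (f : surj n m) x :
  (t m \o s m) (low M f x) = low P f ((t n \o s n) x).
Proof. by rewrite /= !jfun_low. Qed.

Lemma janus_comp_up n m (phi : osurj n m) x :
  (t n \o s n) (up M phi x) = up P phi ((t m \o s m) x).
Proof. by rewrite /= !jfun_up. Qed.

Definition janus_comp : janus_hom M P :=
  @JanusHom M P (fun n => t n \o s n) janus_comp_low janus_comp_up.

End JanusComp.

Lemma janus_comp1m M N (s : janus_hom M N) : janus_comp (janus_id N) s = s.
Proof. exact: janus_hom_eq. Qed.

Lemma janus_compm1 M N (s : janus_hom M N) : janus_comp s (janus_id M) = s.
Proof. exact: janus_hom_eq. Qed.

Lemma janus_compA M N P Q (u : janus_hom P Q) (t : janus_hom N P)
    (s : janus_hom M N) :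
  janus_comp u (janus_comp t s) = janus_comp (janus_comp u t) s.
Proof. exact: janus_hom_eq. Qed.

Definition Janus_cat : category :=
  @Category janus janus_hom janus_id janus_comp
    janus_comp1m janus_compm1 janus_compA.

Record pseudo_mackey (M : janus) : Prop := PseudoMackey {
  pm_iso : forall a (f : surj a a) (u : osurj a a), double_iso f u ->
    forall x : M a, low M f (up M u x) = x;
  pm_square : forall a b c d (f : surj a b) (g : surj c d) (phi : osurj a c)
    (psi : osurj b d), square f g phi psi ->
    forall x : M c, up M psi (low M g x) =
      (\sum_(A : {A : {set 'I_a} | admissible f phi A})
         low M (surj_restr A) (up M (osurj_restr A) x))%R }.

Definition PMack : category := @full_subcat Janus_cat pseudo_mackey.

Definition PMack_le (n : nat) : category :=
  @full_subcat PMack (fun M =>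
    ab_zero (sval M 0%N) /\ forall m : nat, (n < m)%N -> ab_zero (sval M m)).

(* Main.v *)
From HB Require Import structures.
From mathcomp Require Import all_boot all_order all_algebra.
From mathcomp Require Import monoid boolp.
Require Import Defs.
Set Implicit Arguments.
Unset Strict Implicit.
Unset Printing Implicit Defensive.
Import GRing.Theory Num.Theory.
Import Algebra.
Local Open Scope ring_scope.

(** Let [FG m] be the free group on [m] generators.  To a functor [F] one attaches
    its cross-effects at free groups of rank one, [cr F m], the subgroup of
    [F (FG m)] killed by the endomorphisms that kill a generator.  A surjection of
    sets induces a morphism of free groups, hence [M_*].  A surjection with ordered
    fibres induces the comultiplication sending [x_j] to the ordered product of the
    generators in the fibre of [j]; following it by the idempotent [eps] of
    [F (FG m)] with image [cr F m] gives [M^*].  A square of the double category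
    commutes on free groups ([square_comul]), and cutting [F (FG a)] into the
    cross-effects of the subsets of [a] turns this commutation into the sum over
    admissible subsets ([cr_pseudo_mackey]).  Vanishing above [n] is the polynomial
    condition.  This is the functor [Phi].

    In the other direction Yoneda forces the answer: an element of [Psi M X] should
    be a morphism from the pseudo-Mackey functor of [Z[gr(X, -)]] to [M], that is a
    family of functions [gr(X, FG m) -> M m] subject to three naturality conditions
    ([natural_fam]).  Functoriality in [X] is composition.  The condition on [M_*]
    expresses the iterated differences of the functions of the family through the
    values of [M] at large sets, which are zero, so that [Psi M] is polynomial
    ([ev_Delta0], [Psi_polynomial]).

    Evaluation at the identity is a morphism [counit : Phi (Psi M) -> M], and
    [x |-> (h |-> eps (F h x))] is a morphism [unit_trans : F -> Psi (Phi F)].  They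
    satisfy a triangle identity, and [Phi] detects isomorphisms ([nt_bij]); hence
    everything rests on the bijectivity of the counit at each [r].

    - Injectivity ([ev_eq0]).  Let a family on [FG r] be killed by the retractions
      and vanish at the identity.  A morphism [FG r -> FG k] with positive words as
      coordinates factors as a comultiplication followed by a map of sets, whence
      the vanishing of the family there.  Arbitrary coordinates are reached because
      the family is a polynomial function of them: the list of all its iterated
      differences at [g] determines the same list at [g x] and at [g x^-1], by
      the unipotent operators [e |-> e + e(l :: _)].

    - Surjectivity ([bracket_id]).  Given [y] in [M r], a word [w] in pairs of indices
      is a span [r <- size w -> k], and it acts on [y] by [M_* M^*] when both legs are
      surjective ([bracket]).  The value of the family at [h] is the sum of these
      elements weighted by the coefficients of the truncated Magnus expansion of the
      coordinates of [h].  Dually, the free group acts on functions of words by the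
      same unipotent operators, and the value is read off at the empty word
      ([magnus]).  Every naturality condition then reduces, by intertwining
      the actions of generators ([magnus_intertwine]), to an identity between
      functions of words; the one about [M^*] is the defining relation of pseudo-Mackey
      functors applied to a pullback listed lexicographically ([up_wbracket]). *)

(** * Equivalences of categories *)

Definition is_bij (A B : Type) (f : A -> B) : Prop :=
  injective f /\ (forall y, exists x, f x = y).

Lemma is_bij_inv (A B : Type) (f : A -> B) :
  is_bij f -> exists g : B -> A, cancel f g /\ cancel g f.
Proof.
move=> [fI fS]; exists (fun y => sval (cid (fS y))).
have gK y : f (sval (cid (fS y))) = y by case: cid.
by split=> // x; apply: fI.
Qed.

Lemma additive_inverse (U V : zmodType) (f : {additive U -> V}) :
  is_bij f -> exists g : {additive V -> U}, cancel f g /\ cancel g f.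
Proof.
move=> /is_bij_inv [g [fK gK]].
have gB : zmod_morphism g by move=> x y; apply: (can_inj fK); rewrite raddfB !gK.
pose gL := GRing.isZmodMorphism.Build V U g gB.
by exists (HB.pack_for {additive V -> U} g gL).
Qed.

Lemma nat_trans_iso (C D : category) (F G : functor C D) (a : nat_trans F G) :
  (forall x, is_iso (a x)) -> @is_iso (functor_cat C D) F G a.
Proof.
move=> /(_ _)/cid ai; pose b x := sval (ai x).
have bP x : cmp (b x) (a x) = idm _ /\ cmp (a x) (b x) = idm _ by rewrite /b; case: (ai x).
have bN x y (f : hom x y) : cmp (b y) (fmap (fmor G) f) = cmp (fmap (fmor F) f) (b x).
  rewrite -[LHS]cmpm1 -(proj2 (bP x)) cmpA -[cmp (cmp (b y) _) _]cmpA -ntN.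
  by rewrite cmpA (proj1 (bP y)) cmp1m.
exists (NatTrans bN); split; apply: nat_trans_eq => x /=.
- exact: (proj1 (bP x)).
- exact: (proj2 (bP x)).
Qed.

Lemma janus_iso (M N : janus) (s : janus_hom M N) :
  (forall n, is_bij (s n)) -> @is_iso Janus_cat M N s.
Proof.
move=> /(_ _)/additive_inverse/cid si; pose t n := sval (si n).
have tP n : cancel (s n) (t n) /\ cancel (t n) (s n) by rewrite /t; case: (si n).
have tl n m (f : surj n m) x : t m (low N f x) = low M f (t n x).
  by apply: (can_inj (proj1 (tP m))); rewrite jfun_low (proj2 (tP m)) (proj2 (tP n)).
have tu n m (phi : osurj n m) x : t n (up N phi x) = up M phi (t m x).
  by apply: (can_inj (proj1 (tP n))); rewrite jfun_up (proj2 (tP m)) (proj2 (tP n)).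
exists (JanusHom tl tu); split; apply: janus_hom_eq => n x /=.
- exact: (proj1 (tP n)).
- exact: (proj2 (tP n)).
Qed.

Lemma ab_iso (U V : Ab) (f : hom U V) : is_bij (ab_app f) -> is_iso f.
Proof.
move=> /additive_inverse [g [fK gK]]; exists g.
by split; apply: additive_eq => x; [exact: fK | exact: gK].
Qed.

(** Exchanges the morphisms of [gr] and [Ab] for the group morphisms and additive
    maps which they are, so that both can be applied to elements. *)
Definition act (F : functor gr Ab) (X Y : gr)
    (h : {ghom (sval X : groupType) -> (sval Y : groupType)}) :
    {additive (F X : zmodType) -> (F Y : zmodType)} :=
  fmap (fmor F) (h : @hom gr X Y).

Lemma act_id (F : functor gr Ab) (X : gr) x : @act F X X idfun x = x.
Proof. by rewrite /act (fmap1 (fmor F) X). Qed.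

Lemma act_comp (F : functor gr Ab) (X Y Z : gr)
    (g : {ghom (sval Y : groupType) -> (sval Z : groupType)})
    (h : {ghom (sval X : groupType) -> (sval Y : groupType)}) x :
  act F (g \o h) x = act F g (act F h x).
Proof. by rewrite /act (fmapM (fmor F) (g : @hom gr Y Z) (h : @hom gr X Y)). Qed.

Lemma act_nat (F G : functor gr Ab) (a : nat_trans F G) X Y
   (h : {ghom (sval X : groupType) -> (sval Y : groupType)}) x :
  ab_app (a Y) (act F h x) = act G h (ab_app (a X) x).
Proof. exact: (congr1 (fun k => ab_app k x) (ntN a (h : @hom gr X Y))). Qed.

(** * Finitely generated free groups *)

Section IntegerPowers.
Variable H : groupType.

Definition zexp (x : H) (z : int) : H :=
  match z with Posz n => x ^+ n | Negz n => x ^- n.+1 end%g.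

Lemma zexpS x z : (zexp x (z + 1) = zexp x z * x)%g.
Proof.
case: z => [n|[|n]]; first by rewrite addrC -intS /= expgSr.
  by rewrite NegzE addNr /= expg1 mulVg.
rewrite (_ : Negz n.+1 + 1 = Negz n); last by rewrite !NegzE intS opprD addrC addrA subrr add0r.
by rewrite /= [(x ^+ n.+2)%g]expgS invgM mulgVK.
Qed.

Lemma zexpD x a b : (zexp x (a + b) = zexp x a * zexp x b)%g.
Proof.
have NegS n : Negz n.+1 + 1 = Negz n by rewrite !NegzE intS opprD addrC addrA subrr add0r.
case: b => n; elim: n => [|n IH].
- by rewrite addr0 mulg1.
- by rewrite intS [1 + _]addrC addrA !zexpS IH mulgA.
- by apply: (mulIg x); rewrite -zexpS NegzE addrNK /= expg1 mulgVK.
- by apply: (mulIg x); rewrite -mulgA -!zexpS -addrA NegS IH.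
Qed.

End IntegerPowers.

Definition Zgrp : Type := int.
HB.instance Definition _ := Choice.on Zgrp.
Definition Zmul (a b : Zgrp) : Zgrp := (a + b)%R.
Definition Zinv (a : Zgrp) : Zgrp := (- a)%R.
HB.instance Definition _ := isGroup.Build Zgrp
  (@addrA int : associative Zmul) (@add0r int : left_id (0 : int) Zmul)
  (@addr0 int : right_id (0 : int) Zmul)
  (@addNr int : left_inverse (0 : int) Zinv Zmul)
  (@addrN int : right_inverse (0 : int) Zinv Zmul).

Section ZexpMorphism.
Variables (H : groupType) (x : H).

Lemma zexp_morphism : monoid.monoid_morphism (zexp x : Zgrp -> H).
Proof. by split=> // a b; exact: zexpD. Qed.

HB.instance Definition _ :=
  isUMagmaMorphism.Build Zgrp H (zexp x : Zgrp -> H) zexp_morphism.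

Definition zexp_hom : {ghom Zgrp -> H} := (zexp x : Zgrp -> H).

End ZexpMorphism.

Definition Zgen : Zgrp := 1 : int.

Lemma zexp_gen (a : Zgrp) : zexp Zgen a = a.
Proof.
have E n : (Zgen ^+ n)%g = Posz n.
  by elim: n => // n IH; rewrite expgSr IH; apply: etrans (esym (intS n)); rewrite addrC.
by case: a => n /=; rewrite E.
Qed.

Lemma Zgrp_fg_free : @fg_free Zgrp.
Proof.
exists unit, (fun _ => Zgen) => H h; exists (zexp_hom (h tt)); split=> [[]|phi phiP].
  by rewrite /zexp_hom /= expg1.
apply: ghom_eq => a; rewrite -[in RHS](zexp_gen a) /zexp_hom /=.
by case: a => n /=; rewrite ?gmulfV gmulfXn (phiP tt).
Qed.

Definition ZG : gr := exist fg_free (Zgrp : groupType) Zgrp_fg_free.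

Notation "X ~> Y" := {ghom (sval X : groupType) -> (sval Y : groupType)}
  (at level 99, Y at level 200) : type_scope.

Definition FG (T : finType) : gr := vee (fun _ : T => ZG).

Section FreeGroup.
Variable T : finType.

Definition gen (t : T) : (sval (FG T) : groupType) := fprod_in (fun _ : T => Zgrp : groupType) t Zgen.

Lemma lift_exists (H : groupType) (h : T -> H) :
  exists f : {ghom (sval (FG T) : groupType) -> H}, forall t, f (gen t) = h t.
Proof.
exists (@fprod_case T (fun _ : T => Zgrp : groupType) H (fun t => zexp_hom (h t))) => t.
by rewrite /gen fprod_caseK /zexp_hom /= expg1.
Qed.

Definition lift (H : groupType) (h : T -> H) : {ghom (sval (FG T) : groupType) -> H} :=
  sval (cid (lift_exists h)).

Lemma lift_gen (H : groupType) (h : T -> H) t : lift h (gen t) = h t.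
Proof. exact: (svalP (cid (lift_exists h))). Qed.

(** Inverses of generators are treated on the same footing as generators, so that
    a property which is invariant under right multiplication by generators
    is settled at the identity. *)
Lemma free_ind (P : (sval (FG T) : groupType) -> Prop) :
  P 1%g -> (forall g t, P g <-> P (g * gen t)%g) -> forall g, P g.
Proof.
move=> P1 PM g; rewrite (fprod_word g).
elim/last_ind: (repr g) => [|w [t a] IH]; first by rewrite big_nil.
rewrite -cats1 big_cat big_seq1 /=; move: (\big[_/_]_(_ <- w) _) IH => x Px.
rewrite -(zexp_gen a).
have PX n y : P y <-> P (y * gen t ^+ n)%g.
  elim: n y => [|n IH] y; first by rewrite expg0 mulg1.
  by rewrite expgS mulgA; apply: iff_trans (IH _); exact: PM.
case: a => n; rewrite /zexp ?gmulfV gmulfXn.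
  exact: (PX n x).1.
by apply: (PX n.+1 _).2; rewrite mulgVK.
Qed.

Lemma free_eq (H : groupType) (f g : {ghom (sval (FG T) : groupType) -> H}) :
  (forall t, f (gen t) = g (gen t)) -> f = g.
Proof.
move=> E; apply: ghom_eq; apply: free_ind => [|x t]; first by rewrite !gmulf1.
by rewrite !gmulfM E; split=> [->|/mulIg].
Qed.

Definition gword (s : seq T) : (sval (FG T) : groupType) := (\prod_(t <- s) gen t)%g.

End FreeGroup.

(** * Families of functions on the morphisms from a group *)

Section Families.
Variables (M : janus) (X : gr).

Definition fam : Type := forall m, (X ~> FG 'I_m) -> M m.

HB.instance Definition _ := gen_eqMixin fam.
HB.instance Definition _ := gen_choiceMixin fam.

Lemma fam_eq (a b : fam) : (forall m h, a m h = b m h) -> a = b.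
Proof.
move=> E; apply: functional_extensionality_dep => m.
by apply: functional_extensionality_dep => h; exact: E.
Qed.

Definition fam0 : fam := fun m h => 0.
Definition famN (a : fam) : fam := fun m h => - a m h.
Definition famD (a b : fam) : fam := fun m h => a m h + b m h.

Lemma famDA : associative famD.
Proof. by move=> a b c; apply: fam_eq => m h; exact: addrA. Qed.
Lemma famDC : commutative famD.
Proof. by move=> a b; apply: fam_eq => m h; exact: addrC. Qed.
Lemma fam0D : left_id fam0 famD.
Proof. by move=> a; apply: fam_eq => m h; exact: add0r. Qed.
Lemma famNK : left_inverse fam0 famN famD.
Proof. by move=> a; apply: fam_eq => m h; exact: addNr. Qed.

HB.instance Definition _ := GRing.isZmodule.Build fam famDA famDC fam0D famNK.

End Families.

(** * Alternating sums over sublists *)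

Section Sublists.
Variable T : eqType.
Implicit Types (s u v : seq T).

Fixpoint subs s : seq (seq T) :=
  if s is x :: s' then subs s' ++ [seq x :: u | u <- subs s'] else [:: [::]].

Lemma mem_subs s u : (u \in subs s) = subseq u s.
Proof.
elim: s u => [|x s IH] u; first by rewrite inE; case: u.
rewrite mem_cat IH; apply/orP/idP => [[/subseq_trans|/mapP[v]]|].
- by apply; exact: subseq_cons.
- by rewrite IH => sv ->; rewrite /= eqxx.
- case: u => [_|y u /=]; first by left; exact: sub0seq.
  case: eqP => [-> su|_ su]; last by left.
  by right; apply/mapP; exists u; rewrite ?IH.
Qed.

Lemma uniq_subs s : uniq s -> uniq (subs s).
Proof.
elim: s => //= x s IH /andP[xs /IH us]; rewrite cat_uniq us map_inj_uniq ?us; last by move=> ? ? [].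
rewrite andbT; apply/hasPn => _ /mapP[u _ ->]; rewrite mem_subs.
by apply/negP => /mem_subseq /(_ x); rewrite mem_head (negPf xs) => /(_ isT).
Qed.

Variable A : zmodType.

(** The sum of [(-1)^(size s - size u) G u] over the sublists [u] of [s], in other
    words the iterated difference of [G] at the empty list in the directions of [s];
    the recursion spares the signs. *)
Fixpoint Delta s (G : seq T -> A) : A :=
  if s is x :: s' then Delta s' (fun u => G (x :: u)) - Delta s' G else G [::].

Lemma Delta_eq s G G' :
  (forall u, subseq u s -> G u = G' u) -> Delta s G = Delta s G'.
Proof.
elim: s G G' => [|x s IH] G G' E /=; first exact: E.
congr (_ - _); apply: IH => u su; apply: E; first by rewrite /= eqxx.
exact: subseq_trans su (subseq_cons _ _).
Qed.

Lemma DeltaD s G G' : Delta s (fun u => G u + G' u) = Delta s G + Delta s G'.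
Proof. by elim: s G G' => //= x s IH G G'; rewrite !IH opprD addrACA. Qed.

Lemma DeltaN s G : Delta s (fun u => - G u) = - Delta s G.
Proof. by elim: s G => //= x s IH G; rewrite !IH opprD. Qed.

Lemma Delta_const0 s : Delta s (fun=> 0) = 0.
Proof. by elim: s => //= x s IH; rewrite IH subrr. Qed.

Lemma Delta_eq0 s G : (forall u, subseq u s -> G u = 0) -> Delta s G = 0.
Proof. by move=> E; rewrite (Delta_eq E) Delta_const0. Qed.

Lemma Delta_top s G :
  (forall u, subseq u s -> u != s -> G u = 0) -> Delta s G = G s.
Proof.
elim: s G => //= x s IH G E; rewrite IH => [|u su us]; last by apply: E; rewrite ?eqseq_cons /= eqxx.
rewrite Delta_eq0 ?subr0 // => u su; apply: E; first exact: subseq_trans su (subseq_cons _ _).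
by apply/eqP => E'; have := size_subseq su; rewrite E' /= ltnn.
Qed.

(** The sublists with and without [i] contribute opposite terms. *)
Lemma Delta_indep i s G : i \in s ->
  (forall u, G u = G (filter (predC1 i) u)) -> Delta s G = 0.
Proof.
elim: s G => //= x s IH G; rewrite inE => /predU1P[<-|si] E.
  rewrite (@Delta_eq _ _ G) ?subrr // => u _.
  by rewrite E [RHS]E /= eqxx.
by rewrite !IH ?subrr // => u; rewrite E [RHS]E /= filter_id.
Qed.

(** Moebius inversion on the lattice of subsets. *)
Lemma sum_Delta s G : G s = \sum_(u <- subs s) Delta u G.
Proof.
elim: s G => [|x s IH] G; first by rewrite big_seq1.
rewrite (IH (fun u => G (x :: u))) /= big_cat /= big_map -big_split.
by apply: eq_bigr => u _ /=; rewrite addrC subrK.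
Qed.

(** A function of finite sets of degree at most [n] has vanishing [n+1]-st
    differences at every base point [z], not only at the empty set: moving a point
    [x] out of the base point writes a difference in the directions [s] as the sum of
    one in the directions [x :: s] and one in the directions [s]. *)
Lemma Delta_shift n G : (forall u v, u =i v -> G u = G v) ->
  (forall s, uniq s -> (n < size s)%N -> Delta s G = 0) ->
  forall z s, uniq (z ++ s) -> (n < size s)%N -> Delta s (fun u => G (z ++ u)) = 0.
Proof.
move=> Gext G0; elim=> [|x z IH] s; first exact: G0.
rewrite cat_cons /= => /andP[xzs uzs] ns.
have /eqP : Delta (x :: s) (fun u => G (z ++ u)) = 0.
  apply: IH; last exact: leqW.
  have /perm_uniq -> : perm_eq (z ++ x :: s) (x :: z ++ s) by rewrite (perm_catCA z [:: x] s).
  by rewrite /= xzs.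
rewrite /= (IH s) // subr0 => /eqP <-; apply: Delta_eq => u _.
by apply: Gext => y; rewrite inE !mem_cat inE orbCA.
Qed.

End Sublists.

Lemma filter_swap (T : Type) (a b : pred T) s : filter a (filter b s) = filter b (filter a s).
Proof. by rewrite -!filter_predI; apply: eq_filter => x /=; rewrite andbC. Qed.

Lemma Delta_map (S T : eqType) (A : zmodType) (f : S -> T) s (G : seq T -> A) :
  Delta (map f s) G = Delta s (fun u => G (map f u)).
Proof. by elim: s G => //= x s IH G; rewrite !IH. Qed.

Lemma subs_map (S T : eqType) (f : S -> T) s : subs (map f s) = map (map f) (subs s).
Proof. by elim: s => //= x s ->; rewrite map_cat -!map_comp. Qed.

Lemma raddf_Delta (T : eqType) (A B : zmodType) (f : {additive A -> B}) s (G : seq T -> A) :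
  f (Delta s G) = Delta s (fun u => f (G u)).
Proof. by elim: s G => //= x s IH G; rewrite raddfB !IH. Qed.

Lemma sum_subs_set (T : finType) (A : zmodType) (G : seq T -> A) :
  \sum_(u <- subs (enum T)) G u = \sum_(B : {set T}) G (enum B).
Proof.
rewrite -(big_map (fun B : {set T} => enum B) xpredT G); apply: perm_big.
apply: uniq_perm.
- exact/uniq_subs/enum_uniq.
- rewrite map_inj_uniq; first by rewrite /index_enum -enumT enum_uniq.
  by move=> B C E; apply/setP => x; rewrite -mem_enum E mem_enum.
move=> u; rewrite mem_subs; apply/idP/mapP => [su|[B _ ->]]; last first.
  by rewrite [enum T]enumT [enum B]/enum_mem filter_subseq.
exists [set x in u]; first exact: mem_index_enum.
rewrite [LHS](subseq_uniqP (enum_uniq T) su) [enum T]enumT [RHS]/enum_mem.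
by apply: eq_filter => x; rewrite !inE.
Qed.

(** * Morphisms between free groups *)

Definition gcomp (G H K : groupType) (g : {ghom H -> K}) (h : {ghom G -> H}) :
  {ghom G -> K} := g \o h.

Notation "g \oo h" := (gcomp g h) (at level 50, left associativity).

Lemma gcompE (G H K : groupType) (g : {ghom H -> K}) (h : {ghom G -> H}) x :
  (g \oo h) x = g (h x).
Proof. by []. Qed.

Lemma gcompA (G H K L : groupType) (g : {ghom K -> L}) (h : {ghom H -> K})
  (k : {ghom G -> H}) : g \oo (h \oo k) = g \oo h \oo k.
Proof. exact: ghom_eq. Qed.

Lemma act_gcomp (F : functor gr Ab) (X Y Z : gr) (g : Y ~> Z) (h : X ~> Y) x :
  act F (g \oo h) x = act F g (act F h x).
Proof. exact: act_comp. Qed.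

(** Partial maps act on free groups, the generators outside the domain being
    sent to the identity. *)
Definition pm (S T : finType) (f : S -> option T) : FG S ~> FG T :=
  lift (fun s => oapp (@gen T) 1%g (f s)).

Arguments pm : simpl never.

Lemma pm_gen (S T : finType) (f : S -> option T) s : pm f (gen s) = oapp (@gen T) 1%g (f s).
Proof. exact: lift_gen. Qed.

Lemma pm_ext (S T : finType) (f g : S -> option T) : f =1 g -> pm f = pm g.
Proof. by move=> /funext ->. Qed.

Lemma pm_comp (S T U : finType) (g : T -> option U) (f : S -> option T) :
  pm g \oo pm f = pm (fun s => obind g (f s)).
Proof.
apply: free_eq => s; rewrite gcompE !pm_gen.
by case: (f s) => [t|] /=; rewrite ?pm_gen ?gmulf1.
Qed.

Lemma pm_compE (S T U : finType) (g : T -> option U) (f : S -> option T) x :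
  pm g (pm f x) = pm (fun s => obind g (f s)) x.
Proof. by rewrite -gcompE pm_comp. Qed.

Lemma pm_some (T : finType) x : pm (@Some T) x = x.
Proof.
by rewrite (_ : pm (@Some T) = idfun) //; apply: free_eq => t; rewrite pm_gen.
Qed.

Definition on (S T : finType) (u : seq S) (f : S -> T) s :=
  if s \in u then Some (f s) else None.

(** The retraction onto the free factor on [u], as an endomorphism. *)
Notation fkill u := (pm (on u id)).

Lemma on_ext (S T : finType) (u v : seq S) (f : S -> T) : u =i v -> on u f = on v f.
Proof. by move=> E; apply/funext => s; rewrite /on E. Qed.

Lemma pm_on_comp (S T U : finType) (v : seq T) (g : T -> U) (u : seq S) (f : S -> T) :
  pm (on v g) \oo pm (on u f) = pm (on [seq s <- u | f s \in v] (g \o f)).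
Proof.
rewrite pm_comp; apply: pm_ext => s; rewrite /on mem_filter andbC.
by case: ifP => //=.
Qed.

Lemma on_enum (S T : finType) (f : S -> T) : on (enum S) f = Some \o f.
Proof. by apply/funext => s; rewrite /on mem_enum. Qed.

Arguments gword : simpl never.
Arguments act : simpl never.

Lemma gmulf_gword (T : finType) (H : groupType)
    (f : {ghom (sval (FG T) : groupType) -> H}) s :
  f (gword s) = (\prod_(t <- s) f (gen t))%g.
Proof. by rewrite /gword gmulf_prod. Qed.

Lemma gword_cat (T : finType) (s t : seq T) : gword (s ++ t) = (gword s * gword t)%g.
Proof. by rewrite /gword big_cat. Qed.

Lemma pm_gword (S T : finType) (f : S -> option T) s : pm f (gword s) = gword (pmap f s).
Proof.
rewrite gmulf_gword /gword; elim: s => [|x s IH] /=; first by rewrite !big_nil.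
by rewrite big_cons IH pm_gen; case: (f x) => [y|] /=; rewrite ?big_cons ?mul1g.
Qed.

Lemma pmap_on (S T : finType) (u : seq S) (f : S -> T) s :
  pmap (on u f) s = map f [seq x <- s | x \in u].
Proof. by elim: s => //= x s IH; rewrite /on; case: ifP => _ /=; rewrite IH. Qed.

(** ** Comultiplications *)

Definition fibre n m (f : 'I_n -> 'I_m) (j : 'I_m) := [seq i <- enum 'I_n | f i == j].

Definition ofibre n m (phi : osurj n m) (j : 'I_m) := sort (ole phi) (fibre phi j).

(** The comultiplication attached to a surjection with ordered fibres; composition
    in the category of these surjections is ordered exactly so as to make it
    contravariant ([comul_comp]). *)
Definition comul n m (phi : osurj n m) : FG 'I_m ~> FG 'I_n :=
  lift (fun j => gword (ofibre phi j)).

Arguments comul : simpl never.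

Lemma mem_ofibre n m (phi : osurj n m) j i : (i \in ofibre phi j) = (phi i == j).
Proof. by rewrite mem_sort mem_filter mem_enum andbT. Qed.

Lemma uniq_ofibre n m (phi : osurj n m) j : uniq (ofibre phi j).
Proof. by rewrite sort_uniq filter_uniq // enum_uniq. Qed.

Lemma sorted_ofibre n m (phi : osurj n m) j : sorted (ole phi) (ofibre phi j).
Proof.
apply: (@sort_sorted_in _ [pred i | phi i == j] (ole phi)).
  by move=> x y /eqP xj /eqP yj; apply: fo_total (oleP phi) _ _ _; rewrite xj yj.
by apply/allP => x; rewrite mem_filter => /andP[].
Qed.

(** A duplicate-free sorted list is determined by its members. *)
Lemma ofibre_uniqueness n m (phi : osurj n m) j s :
  uniq s -> (forall i, (i \in s) = (phi i == j)) -> sorted (ole phi) s -> s = ofibre phi j.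
Proof.
move=> us ms ss; apply: (sorted_eq (fo_trans (oleP phi)) (fo_anti (oleP phi)) ss).
  exact: sorted_ofibre.
by apply: uniq_perm => // [|i]; rewrite ?uniq_ofibre // ms mem_ofibre.
Qed.

Lemma comul_gen n m (phi : osurj n m) j : comul phi (gen j) = gword (ofibre phi j).
Proof. exact: lift_gen. Qed.

Lemma sorted_flatten (T U : eqType) (r : rel T) (F : U -> seq T) (s : seq U) (r' : rel U) :
  (forall x, sorted r (F x)) -> transitive r ->
  (forall x y a b, r' x y -> a \in F x -> b \in F y -> r a b) ->
  pairwise r' s -> sorted r (flatten (map F s)).
Proof.
move=> Fs rt rr' ps; rewrite sorted_pairwise //.
elim: s ps => //= x s IH /andP[xs ps]; rewrite pairwise_cat -sorted_pairwise // Fs IH // !andbT.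
apply/allrelP => a b aF /flatten_mapP[y ys bF]; apply: rr' aF bF.
exact: (allP xs).
Qed.

Lemma comul_id m : comul (osurj_id m) = idfun.
Proof.
apply: free_eq => j; rewrite comul_gen -(@ofibre_uniqueness _ _ (osurj_id m) j [:: j]) //.
  by rewrite /gword big_seq1.
by move=> i; rewrite inE.
Qed.

Lemma comul_comp n m k (psi : osurj m k) (phi : osurj n m) :
  comul (osurj_comp psi phi) = comul phi \oo comul psi.
Proof.
apply: free_eq => j; rewrite gcompE !comul_gen gmulf_gword.
rewrite -(@ofibre_uniqueness _ _ (osurj_comp psi phi) j (flatten [seq ofibre phi i | i <- ofibre psi j])).
- rewrite /gword big_flatten /= big_map; apply: eq_bigr => i _; by rewrite comul_gen.
- have := uniq_ofibre psi j; elim: (ofibre psi j) => //= x s IH /andP[xs us].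
  rewrite cat_uniq uniq_ofibre IH // andbT; apply/hasPn => i /flatten_mapP[y ys].
  by rewrite mem_ofibre => /eqP iy; rewrite mem_ofibre iy; apply: contraNneq xs => <-.
- move=> i; apply/flatten_mapP/idP => [[y]|/= ij]; first by rewrite !mem_ofibre /= => /eqP <- /eqP->.
  by exists (phi i); rewrite mem_ofibre.
apply: (@sorted_flatten _ _ _ _ _ (fun x y => (x != y) && ole psi x y)).
- move=> x; apply: (@sub_in_sorted _ [pred i | phi i == x] (ole phi)); last exact: sorted_ofibre.
    by move=> a b /eqP ax /eqP bx ab; rewrite /= /ole_comp ax bx eqxx.
  by apply/allP => i; rewrite mem_ofibre.
- exact: fo_trans (oleP (osurj_comp psi phi)).
- move=> x y a b /andP[xy psixy]; rewrite !mem_ofibre => /eqP ax /eqP bx.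
  by rewrite /= /ole_comp ax bx (negPf xy).
rewrite (pairwise_relI (fun x y => x != y)) -uniq_pairwise uniq_ofibre /=.
by rewrite -(sorted_pairwise (fo_trans (oleP psi))) sorted_ofibre.
Qed.

Section PositionOrder.
Variables (n m : nat) (f : surj n m).

(** The order carried by the fibres of a span that is given by a word. *)
Definition pos_le : rel 'I_n := fun i j => (f i == f j) && (i <= j)%N.

Lemma pos_le_order : fibre_order f pos_le.
Proof.
split; rewrite /pos_le.
- by move=> x y /andP[/eqP].
- by move=> x; rewrite eqxx leqnn.
- move=> x y /andP[/andP[_ xy] /andP[_ yx]]; apply: val_inj; apply/eqP.
  by rewrite eqn_leq xy yx.
- by move=> y x z /andP[/eqP-> xy] /andP[-> yz]; exact: leq_trans yz.
- by move=> x y ->; rewrite eqxx leq_total.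
Qed.

Definition pos_osurj := OSurj pos_le_order.

Lemma ofibre_pos j : ofibre pos_osurj j = fibre f j.
Proof.
apply/esym/ofibre_uniqueness => [|i|]; first by rewrite filter_uniq ?enum_uniq.
  by rewrite mem_filter mem_enum andbT.
apply: (@sub_in_sorted _ [pred i | f i == j] (fun x y => x <= y)%N).
- by move=> a b /eqP aj /eqP bj ab; rewrite /= /pos_le aj bj eqxx.
- by apply/allP => i; rewrite mem_filter => /andP[].
apply: sorted_filter; first by move=> ? ? ?; exact: leq_trans.
by rewrite -(@sorted_map _ _ (@nat_of_ord n) leq) val_enum_ord iota_sorted.
Qed.

End PositionOrder.

(** * Subgroups cut out by a predicate *)

Section SubZmodule.
Variables (V : zmodType) (P : V -> Prop).
Hypotheses (P0 : P 0) (PB : forall x y, P x -> P y -> P (x - y)).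

Definition subz of P 0 & (forall x y, P x -> P y -> P (x - y)) := {x : V | P x}.

Local Notation S := (subz P0 PB).

HB.instance Definition _ := gen_eqMixin S.
HB.instance Definition _ := gen_choiceMixin S.

Definition subz_val_fun (x : S) : V := sval x.
Lemma subz_val_inj : injective subz_val_fun.
Proof. by move=> [x Px] [y Py] /= E; apply: eq_exist. Qed.

Lemma subz_valP (x : S) : P (subz_val_fun x).
Proof. exact: svalP. Qed.

Definition subz_mk x (Px : P x) : S := exist _ x Px.

Definition subz0 : S := subz_mk P0.
Definition subzB (x y : S) : S := subz_mk (PB (svalP x) (svalP y)).
Definition subzN x := subzB subz0 x.
Definition subzD x y := subzB x (subzN y).

Lemma subzND x y : subz_val_fun (subzD x y) = subz_val_fun x + subz_val_fun y.
Proof. by rewrite /subz_val_fun /= sub0r opprK. Qed.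

Lemma subzDA : associative subzD.
Proof. by move=> x y z; apply: subz_val_inj; rewrite !subzND addrA. Qed.
Lemma subzDC : commutative subzD.
Proof. by move=> x y; apply: subz_val_inj; rewrite !subzND addrC. Qed.
Lemma subz0D : left_id subz0 subzD.
Proof. by move=> x; apply: subz_val_inj; rewrite !subzND add0r. Qed.
Lemma subzNK : left_inverse subz0 subzN subzD.
Proof. by move=> x; apply: subz_val_inj; rewrite subzND /subz_val_fun /= sub0r addNr. Qed.

HB.instance Definition _ := GRing.isZmodule.Build S subzDA subzDC subz0D subzNK.

Lemma subz_val_zmod : zmod_morphism subz_val_fun.
Proof. by move=> x y; rewrite -[x - y]/(subzD x (subzN y)) subzND /subz_val_fun /= sub0r. Qed.

HB.instance Definition _ := GRing.isZmodMorphism.Build S V subz_val_fun subz_val_zmod.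

Definition subz_val : {additive S -> V} := subz_val_fun.

End SubZmodule.

Section SubZmoduleMap.
Variables (V W : zmodType) (P : V -> Prop) (Q : W -> Prop).
Variables (P0 : P 0) (PB : forall x y, P x -> P y -> P (x - y)).
Variables (Q0 : Q 0) (QB : forall x y, Q x -> Q y -> Q (x - y)).
Variables (f : {additive V -> W}) (Pf : forall x, P x -> Q (f x)).

Definition subz_map_fun (x : subz P0 PB) : subz Q0 QB :=
  subz_mk Q0 QB (Pf (subz_valP x)).

Lemma subz_map_zmod : zmod_morphism subz_map_fun.
Proof.
move=> x y; apply: subz_val_inj; rewrite subz_val_zmod.
by rewrite -[LHS]/(f (subz_val_fun (x - y))) subz_val_zmod raddfB.
Qed.

HB.instance Definition _ :=
  GRing.isZmodMorphism.Build (subz P0 PB) (subz Q0 QB) subz_map_fun subz_map_zmod.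

Definition subz_map : {additive subz P0 PB -> subz Q0 QB} := subz_map_fun.

End SubZmoduleMap.

Lemma subz_eq (V : zmodType) (P : V -> Prop) P0 PB (x y : @subz V P P0 PB) :
  subz_val P0 PB x = subz_val P0 PB y -> x = y.
Proof. exact: subz_val_inj. Qed.

(** * From functors to pseudo-Mackey functors *)

Definition others (T : finType) (i : T) := [seq j <- enum T | j != i].

Lemma mem_others (T : finType) (i j : T) : (j \in others i) = (j != i).
Proof. by rewrite mem_filter mem_enum andbT. Qed.

Lemma subseq_enum_missing (T : finType) (u : seq T) :
  subseq u (enum T) -> u != enum T -> exists i, i \notin u.
Proof.
move=> su; apply: contraNP => /forallNP all_in.
apply/eqP; rewrite (subseq_uniqP (enum_uniq T) su); apply/all_filterP/allP => i _ /=.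
by move: (all_in i) => /negP; rewrite negbK.
Qed.

Section CrossEffects.
Variable F : functor gr Ab.

Definition cross (T : finType) (y : (F (FG T) : zmodType)) : Prop :=
  forall i, act F (fkill (others i)) y = 0.

Lemma cross0 T : cross (0 : (F (FG T) : zmodType)).
Proof. by move=> i; rewrite raddf0. Qed.

Lemma crossB T (x y : (F (FG T) : zmodType)) : cross x -> cross y -> cross (x - y).
Proof. by move=> cx cy i; rewrite raddfB /= cx cy subrr. Qed.

(** A morphism that kills a generator factors through a retraction. *)
Lemma cross_kill (T : finType) (Y : gr) (h : FG T ~> Y) i y : cross y ->
  h (gen i) = 1%g -> act F h y = 0.
Proof.
move=> cy hi; have -> : h = h \oo fkill (others i).
  apply: free_eq => t; rewrite gcompE pm_gen /on mem_others.
  by case: eqP => [->|_] //=; rewrite gmulf1.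
by rewrite act_gcomp cy raddf0.
Qed.

(** The idempotent of [F (FG T)] whose image is the cross-effect. *)
Definition eps_fun (T : finType) (y : (F (FG T) : zmodType)) : (F (FG T) : zmodType) :=
  Delta (enum T) (fun u => act F (fkill u) y).

Lemma eps_zmod T : zmod_morphism (@eps_fun T).
Proof.
move=> x y; rewrite /eps_fun -DeltaN -DeltaD; congr Delta; apply/funext => u.
by rewrite raddfB.
Qed.

HB.instance Definition _ T := GRing.isZmodMorphism.Build _ _ (@eps_fun T) (@eps_zmod T).

Definition eps (T : finType) : {additive (F (FG T) : zmodType) -> (F (FG T) : zmodType)} :=
  @eps_fun T.

Lemma epsE (T : finType) y :
  eps T y = Delta (enum T) (fun u => act F (fkill u) y).
Proof. by []. Qed.

Lemma act_fkill_enum (T : finType) (y : (F (FG T) : zmodType)) : act F (fkill (enum T)) y = y.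
Proof.
rewrite (_ : fkill (enum T) = idfun) ?act_id //.
by apply: free_eq => t; rewrite pm_gen /on mem_enum.
Qed.

Lemma eps_cross T y : cross (@eps T y).
Proof.
move=> i; rewrite raddf_Delta; apply: (@Delta_indep _ _ i); first by rewrite mem_enum.
move=> u; rewrite -!act_gcomp !pm_on_comp; congr (act F (pm _) y).
apply: on_ext => j; rewrite !(mem_filter, mem_enum) /=.
by case: (j != i); rewrite ?andbT ?andbF.
Qed.

Lemma eps_id T y : cross y -> @eps T y = y.
Proof.
move=> cy; rewrite /eps /= /eps_fun Delta_top ?act_fkill_enum // => u su.
move=> /(subseq_enum_missing su)[i iu].
by apply: (@cross_kill _ _ _ i) => //; rewrite pm_gen /on (negPf iu).
Qed.

Lemma eps_kill T i y : act F (fkill (others i)) y = y -> @eps T y = 0.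
Proof.
move=> E; apply: (@Delta_indep _ _ i); first by rewrite mem_enum.
move=> u; rewrite -E -!act_gcomp !pm_on_comp; congr (act F (pm _) y).
apply: on_ext => j; rewrite !(mem_filter, mem_enum) /=.
by case: (j != i); rewrite ?andbT ?andbF.
Qed.

Lemma eps_missing (T : finType) (X : gr) (h : X ~> FG T) i x :
  fkill (others i) \oo h = h -> @eps T (act F h x) = 0.
Proof. by move=> E; apply: (@eps_kill _ i); rewrite -act_gcomp E. Qed.

Lemma cross_pm (S T : finType) (f : S -> T) y :
  surj_fun f -> cross y -> cross (act F (pm (Some \o f)) y).
Proof.
move=> fS cy j; have [i fi] := fS j; rewrite -act_gcomp pm_comp.
by apply: (@cross_kill _ _ _ i) => //; rewrite pm_gen /= /on mem_others fi eqxx.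
Qed.

(** The discarded part of [z] comes from proper subsets of the generators; since
    [phi] is surjective, the comultiplication sends it to what [eps] discards. *)
Lemma eps_comul n m (phi : osurj n m) z :
  eps _ (act F (comul phi) (eps _ z)) = eps _ (act F (comul phi) z).
Proof.
rewrite /eps /= {2}/eps_fun !raddf_Delta Delta_top ?act_fkill_enum // => u su.
move=> /(subseq_enum_missing su)[j ju]; have [i ij] := sfunP phi j.
rewrite -act_gcomp; apply: (@eps_missing _ _ _ i); apply: free_eq => t.
rewrite !gcompE pm_gen /on; case: ifP => tu /=; last by rewrite !gmulf1.
rewrite comul_gen pm_gword pmap_on map_id (all_filterP _) //.
apply/allP => k; rewrite mem_ofibre mem_others => /eqP kt.
by apply: contraNneq ju => ki; rewrite -ij -ki kt.
Qed.

Definition cr n : zmodType := subz (@cross0 'I_n) (@crossB 'I_n).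
Definition cr_val n : {additive cr n -> (F (FG 'I_n) : zmodType)} := subz_val _ _.

Lemma cr_valP n (x : cr n) : cross (cr_val n x).
Proof. exact: subz_valP. Qed.

Lemma cr_eq n (x y : cr n) : cr_val n x = cr_val n y -> x = y.
Proof. exact: subz_eq. Qed.

Definition cr_low n m (f : surj n m) : {additive cr n -> cr m} :=
  @subz_map _ _ _ _ (@cross0 'I_n) (@crossB 'I_n) (@cross0 'I_m) (@crossB 'I_m)
    (act F (pm (Some \o f))) (fun x cx => cross_pm (sfunP f) cx).

Definition cr_up n m (phi : osurj n m) : {additive cr m -> cr n} :=
  @subz_map _ _ _ _ (@cross0 'I_m) (@crossB 'I_m) (@cross0 'I_n) (@crossB 'I_n)
    (eps 'I_n \o act F (comul phi)) (fun x _ => eps_cross _).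

Lemma cr_lowE n m (f : surj n m) x : cr_val m (cr_low f x) = act F (pm (Some \o f)) (cr_val n x).
Proof. by []. Qed.

Lemma cr_upE n m (phi : osurj n m) x :
  cr_val n (cr_up phi x) = eps _ (act F (comul phi) (cr_val m x)).
Proof. by []. Qed.

Lemma cr_low1 n : cr_low (surj_id n) = idfun.
Proof.
apply: additive_eq => x; apply: cr_eq; rewrite cr_lowE.
rewrite (_ : pm _ = idfun) ?act_id //; apply: ghom_eq; exact: pm_some.
Qed.

Lemma cr_lowM n m k (g : surj m k) (f : surj n m) :
  cr_low (surj_comp g f) = cr_low g \o cr_low f.
Proof.
apply: additive_eq => x; apply: cr_eq; rewrite cr_lowE.
rewrite -[RHS]/(act F (pm (Some \o g)) (act F (pm (Some \o f)) (cr_val n x))).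
by rewrite -act_gcomp pm_comp.
Qed.

Lemma cr_up1 n : cr_up (osurj_id n) = idfun.
Proof.
apply: additive_eq => x; apply: cr_eq; rewrite cr_upE comul_id act_id eps_id //.
exact: cr_valP.
Qed.

Lemma cr_upM n m k (psi : osurj m k) (phi : osurj n m) :
  cr_up (osurj_comp psi phi) = cr_up phi \o cr_up psi.
Proof.
apply: additive_eq => x; apply: cr_eq; rewrite cr_upE.
rewrite -[RHS]/(eps _ (act F (comul phi) (eps _ (act F (comul psi) (cr_val k x))))).
by rewrite eps_comul comul_comp act_gcomp.
Qed.

Definition cr_janus : janus :=
  @Janus cr (@FunctorOn Omega Ab cr cr_low cr_low1 (fun x y z g f => cr_lowM g f))
    (@FunctorOn (op OmegaAs) Ab cr (fun x y phi => cr_up phi) cr_up1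
       (fun x y z g f => cr_upM f g)).

End CrossEffects.

Section CrossEffectMackey.
Variable F : functor gr Ab.

Lemma comul_bij a (f g : 'I_a -> 'I_a) (u : osurj a a) :
  cancel g f -> cancel f g -> u =1 f -> comul u = pm (Some \o g).
Proof.
move=> gK fK uf; apply: free_eq => j; rewrite comul_gen pm_gen /=.
rewrite -(@ofibre_uniqueness _ _ u j [:: g j]) //; first by rewrite /gword big_seq1.
by move=> i; rewrite inE uf (can2_eq fK gK).
Qed.

(** The order condition of a square makes the two ways of going from the corner [C]
    to the corner [B] agree on free groups. *)
Lemma square_comul a b c d (f : surj a b) (g : surj c d) (phi : osurj a c)
    (psi : osurj b d) : square f g phi psi ->
  comul psi \oo pm (Some \o g) = pm (Some \o f) \oo comul phi.
Proof.
move=> [comm pull ord]; apply: free_eq => z.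
rewrite !gcompE pm_gen /= !comul_gen. rewrite pm_gword.
have fI x x' : phi x = phi x' -> f x = f x' -> x = x'.
  move=> e e'; have [y [_ uy]] := pull (f x) (phi x) (comm x).
  by rewrite -(uy x) // -(uy x').
rewrite (_ : pmap _ _ = map f (ofibre phi z)); last by elim: (ofibre _ _) => //= x s ->.
rewrite -(@ofibre_uniqueness _ _ psi (g z) (map f (ofibre phi z))) //.
- rewrite map_inj_in_uniq ?uniq_ofibre // => x y.
  by rewrite !mem_ofibre => /eqP xz /eqP yz; apply: fI; rewrite xz yz.
- move=> y; apply/mapP/eqP => [[x]|/pull[x [[<- xz] _]]].
    by rewrite mem_ofibre => /eqP xz ->; rewrite comm xz.
  by exists x; rewrite // mem_ofibre xz.
rewrite sorted_map; apply: (@sub_in_sorted _ [pred i | phi i == z] (ole phi)).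
- by move=> x y /eqP xz /eqP yz; rewrite /= ord // xz yz.
- by apply/allP => x; rewrite mem_ofibre.
exact: sorted_ofibre.
Qed.

Lemma enum_set_map n (A : {set 'I_n}) :
  enum A = map (enum_val : 'I_#|A| -> 'I_n) (enum 'I_#|A|).
Proof.
case: (set_0Vmem A) => [->|[x0 _]].
  by rewrite enum_set0 (size0nil (s := enum 'I_#|_|)) // size_enum_ord cards0.
apply: (@eq_from_nth _ x0); first by rewrite size_map size_enum_ord -cardE.
move=> i; rewrite -cardE => iA; have i' := Ordinal iA.
rewrite (nth_map (Ordinal iA)) ?size_enum_ord // (enum_val_nth x0).
by rewrite nth_enum_ord.
Qed.

Section Restrict.
Variables (a b c : nat) (f : surj a b) (phi : osurj a c).
Variable A : {A : {set 'I_a} | admissible f phi A}.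

(** Both lists are sorted for the order of [phi] and have the same members. *)
Lemma ofibre_restr z :
  map (enum_val : 'I_#|val A| -> 'I_a) (ofibre (osurj_restr A) z) =
  [seq x <- ofibre phi z | x \in val A].
Proof.
apply: (sorted_eq (fo_trans (oleP phi)) (fo_anti (oleP phi))).
- by rewrite sorted_map; exact: (sorted_ofibre (osurj_restr A)).
- by apply: sorted_filter; [exact: fo_trans (oleP phi) | exact: sorted_ofibre].
apply: uniq_perm.
- by rewrite (map_inj_uniq enum_val_inj) uniq_ofibre.
- by rewrite filter_uniq // uniq_ofibre.
move=> x; rewrite mem_filter mem_ofibre; apply/mapP/andP => [[i]|[xA xz]].
  by rewrite mem_ofibre => iz ->; rewrite enum_valP.
exists (enum_rank_in xA x); last by rewrite enum_rankK_in.
by rewrite mem_ofibre /= /restr enum_rankK_in.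
Qed.

Lemma restr_comul (v : seq 'I_#|val A|) :
  pm (on (map enum_val v) f) \oo comul phi =
  pm (Some \o surj_restr A) \oo fkill v \oo comul (osurj_restr A).
Proof.
apply: free_eq => z; rewrite !gcompE !comul_gen !pm_gword !pmap_on map_id.
rewrite (_ : pmap _ _ = map (surj_restr A) [seq x <- ofibre (osurj_restr A) z | x \in v]); last first.
  by elim: (filter _ _) => //= x s ->.
congr gword; rewrite [RHS](map_comp f enum_val).
congr map; transitivity [seq x <- [seq x <- ofibre phi z | x \in val A] | x \in map enum_val v].
  rewrite -filter_predI; apply: eq_filter => x /=.
  by rewrite andb_idr // => /mapP[i _ ->]; exact: enum_valP.
rewrite -ofibre_restr filter_map; congr map; apply: eq_filter => i /=.
by rewrite mem_map //; exact: enum_val_inj.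
Qed.

End Restrict.

(** After [square_comul] has moved the set map behind the comultiplication, the
    middle group [F (FG a)] is decomposed over the subsets [A] of [a].  If [A] misses
    a value of [f], the projection [eps] kills its term; if it misses a value of [phi],
    the term factors through a retraction, which kills the cross-effect. *)
Lemma cr_pseudo_mackey : pseudo_mackey (cr_janus F).
Proof.
split=> [a f u [[g fK gK] uf] x|a b c d f g phi psi sq x].
  apply: cr_eq; rewrite -[LHS]/(act F (pm (Some \o f)) (eps F _ (act F (comul u) (cr_val F a x)))).
  rewrite (comul_bij gK fK uf) eps_id; last first.
    by apply: cross_pm; [move=> y; exists (f y) | exact: cr_valP].
  rewrite -act_gcomp pm_comp (_ : pm _ = idfun) ?act_id //.
  by apply: free_eq => t; rewrite pm_gen /= gK.
apply: cr_eq; rewrite raddf_sum /=.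
rewrite -[LHS]/(eps F _ (act F (comul psi) (act F (pm (Some \o g)) (cr_val F c x)))).
rewrite -act_gcomp (square_comul sq); set y := cr_val F c x.
have cy : cross y by exact: cr_valP.
pose G u := eps F _ (act F (pm (on u f) \oo comul phi) y).
have -> : eps F _ (act F (pm (Some \o f) \oo comul phi) y) = G (enum 'I_a).
  by rewrite /G on_enum.
rewrite sum_Delta sum_subs_set.
rewrite (bigID (admissible f phi)) /= [X in _ + X]big1 ?addr0; last first.
  move=> A nA; apply: Delta_eq0 => u uA; rewrite /G.
  have uA' : {subset u <= A} by move=> i /(mem_subseq uA); rewrite mem_enum.
  have [[j fj]|[j phij]] : (exists j, forall i, i \in A -> f i != j) \/
      (exists j, forall i, i \in A -> phi i != j).
    apply: contrapT => /not_orP[/forallNP nf /forallNP nphi]; move/negP: nA; apply; apply/asboolP.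
    have sur k (h : 'I_a -> 'I_k) : (forall j, ~ forall i, i \in A -> h i != j) -> surj_fun (restr h A).
      move=> nh j; apply: contrapT => /forallNP nj; apply: (nh j) => i iA; apply/eqP => hi.
      by apply: (nj (enum_rank_in iA i)); rewrite /restr enum_rankK_in.
    by split; exact: sur.
  - apply: (@eps_missing _ _ _ _ j); rewrite gcompA pm_on_comp; congr (pm _ \oo _).
    apply: on_ext => i; rewrite mem_filter mem_others.
    by apply/andP/idP => [[]//|iu]; split=> //; exact: fj (uA' _ iu).
  - rewrite (@cross_kill _ _ _ _ j) ?raddf0 // gcompE comul_gen pm_gword pmap_on.
    rewrite (_ : filter _ _ = [::]) ?/gword ?big_nil //; apply/eqP; rewrite -(negbK (_ == _)) -has_filter.
    apply/hasPn => i; rewrite mem_ofibre => /eqP ij; apply/negP => /uA' /phij.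
    by rewrite ij eqxx.
rewrite (big_sub (fun A => admissible f phi A)); apply: eq_bigr => A _.
rewrite [in LHS]enum_set_map Delta_map.
set z := act F (comul (osurj_restr A)) y.
transitivity (eps F _ (act F (pm (Some \o surj_restr A)) (eps F _ z))).
  rewrite [in RHS]/eps /= {2}/eps_fun !raddf_Delta; apply: Delta_eq => v _.
  by rewrite /G restr_comul !act_gcomp.
by rewrite eps_id //; apply: cross_pm; [exact: sfunP | exact: eps_cross].
Qed.

End CrossEffectMackey.

(** ** The cross-effect functor *)

Section CrossEffectMorphism.
Variables (F G : functor gr Ab) (a : nat_trans F G).

Definition nt_app (X : gr) : {additive (F X : zmodType) -> (G X : zmodType)} := a X.

Lemma nt_act (X Y : gr) (h : X ~> Y) x : nt_app Y (act F h x) = act G h (nt_app X x).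
Proof. exact: act_nat. Qed.

Lemma nt_eps (T : finType) x : nt_app (FG T) (eps F T x) = eps G T (nt_app (FG T) x).
Proof.
rewrite /eps /= /eps_fun raddf_Delta; apply: Delta_eq => u _.
exact: nt_act.
Qed.

Lemma nt_cross (T : finType) x : cross x -> cross (nt_app (FG T) x).
Proof. by move=> cx i; rewrite -nt_act cx raddf0. Qed.

Definition cr_map n : {additive cr F n -> cr G n} :=
  @subz_map _ _ _ _ (@cross0 F 'I_n) (@crossB F 'I_n) (@cross0 G 'I_n) (@crossB G 'I_n)
    (nt_app (FG 'I_n)) (fun x cx => nt_cross cx).

Lemma cr_mapE n x : cr_val G n (cr_map n x) = nt_app (FG 'I_n) (cr_val F n x).
Proof. by []. Qed.

Lemma cr_map_low n m (f : surj n m) x :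
  cr_map m (low (cr_janus F) f x) = low (cr_janus G) f (cr_map n x).
Proof. by apply: cr_eq; rewrite cr_mapE [LHS]nt_act. Qed.

Lemma cr_map_up n m (phi : osurj n m) x :
  cr_map n (up (cr_janus F) phi x) = up (cr_janus G) phi (cr_map m x).
Proof.
apply: cr_eq; rewrite cr_mapE.
rewrite -[LHS]/(nt_app (FG 'I_n) (eps F _ (act F (comul phi) (cr_val F m x)))).
by rewrite nt_eps nt_act.
Qed.

Definition cr_hom : janus_hom (cr_janus F) (cr_janus G) :=
  @JanusHom (cr_janus F) (cr_janus G) cr_map cr_map_low cr_map_up.

End CrossEffectMorphism.

Lemma vee_case_in (I : finType) (X : I -> gr) (Y : gr) (f : forall i, hom (X i) Y) i
    (x : (sval (X i) : groupType)) :
  (vee_case f : vee X ~> Y) (vee_in X i x) = (f i : X i ~> Y) x.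
Proof. exact: (congr1 (fun g : hom (X i) Y => (g : X i ~> Y) x) (vee_caseK f i)). Qed.

Section VeeKill.
Variables (m : nat) (X : 'I_m -> gr).

Lemma vee_kill_same k (x : (sval (X k) : groupType)) :
  vee_kill X k (vee_in X k x) = 1%g.
Proof.
rewrite /vee_kill -[LHS]/(cmp (vee_case _) (vee_in X k) x) vee_caseK.
by case: {-}_ / idP => // kk; case/eqP: kk.
Qed.

Lemma vee_kill_other k j (jk : j != k) (x : (sval (X j) : groupType)) :
  vee_kill X k (vee_in X j x) =
  vee_in (fun i : {i : 'I_m | i != k} => X (val i)) (exist _ j jk) x.
Proof.
rewrite /vee_kill -[LHS]/(cmp (vee_case _) (vee_in X j) x) vee_caseK.
case: {-}_ / idP => [jk'|]; last by rewrite jk.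
by rewrite (Prop_irrelevance jk' jk).
Qed.

End VeeKill.

Lemma free_rank0 (x : (sval (FG 'I_0) : groupType)) : x = 1%g.
Proof. by elim/free_ind: x => // x []. Qed.

(** The inclusion of [FG 'I_m] into a coproduct of [n+1] copies of itself that
    distributes the generators over the copies has a retraction, so that for
    [n < m] the [m]-th cross-effect embeds into an [n+1]-st one. *)
Lemma cross_vanish n (F : functor gr Ab) : polynomial_le n F ->
  forall m (y : (F (FG 'I_m) : zmodType)), (n < m)%N -> cross y -> y = 0.
Proof.
move=> Fn m y nm cy; pose X := fun _ : 'I_n.+1 => FG 'I_m.
pose p (i : 'I_m) : 'I_n.+1 := inord (minn i n).
pose f : FG 'I_m ~> vee X := lift (fun i => vee_in X (p i) (gen i)).
pose g : vee X ~> FG 'I_m := vee_case (fun _ => idfun : hom (FG 'I_m) (FG 'I_m)).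
have gf : g \oo f = idfun.
  apply: free_eq => i; rewrite gcompE lift_gen.
  exact: (congr1 (fun k : hom (FG 'I_m) (FG 'I_m) => k (gen i)) (vee_caseK _ (p i))).
suff fy : act F f y = 0 by rewrite -[y]act_id -gf act_gcomp fy raddf0.
apply: Fn => k; have km : (k < m)%N by exact: leq_trans (ltn_ord k) nm.
rewrite -[LHS]/(act F (vee_kill X k) (act F f y)) -act_gcomp.
apply: (cross_kill (i := Ordinal km) cy).
have pk : p (Ordinal km) = k.
  by apply: val_inj; rewrite /p /= (minn_idPl _) ?inord_val // -ltnS.
by rewrite gcompE lift_gen pk vee_kill_same.
Qed.

Lemma cr_zero n (F : functor gr Ab) : reduced F -> polynomial_le n F ->
  ab_zero (cr F 0) /\ forall m, (n < m)%N -> ab_zero (cr F m).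
Proof.
move=> F0 Fn; split=> [x|m nm x]; apply: cr_eq; rewrite raddf0.
  by apply: F0; exact: free_rank0.
exact: cross_vanish Fn _ _ nm (cr_valP x).
Qed.

Section CrossEffectFunctor.
Variable n : nat.

Definition Phi_ob (F : Pol n) : PMack_le n :=
  exist _ (exist _ (cr_janus (sval F)) (cr_pseudo_mackey (sval F)))
    (cr_zero (proj1 (svalP F)) (proj2 (svalP F))).

Definition Phi_mor (F G : Pol n) (a : hom F G) : hom (Phi_ob F) (Phi_ob G) :=
  cr_hom (a : nat_trans (sval F) (sval G)).

Lemma Phi_id (F : Pol n) : Phi_mor (idm F) = idm (Phi_ob F).
Proof. by apply: janus_hom_eq => k x; apply: cr_eq. Qed.

Lemma Phi_comp (F G H : Pol n) (b : hom G H) (a : hom F G) :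
  Phi_mor (cmp b a) = cmp (Phi_mor b) (Phi_mor a).
Proof. by apply: janus_hom_eq => k x; apply: cr_eq. Qed.

Definition Phi : functor (Pol n) (PMack_le n) := Functor (FunctorOn Phi_id Phi_comp).

End CrossEffectFunctor.

(** ** Cross-effects detect isomorphisms *)

Section Detect.
Variable F : functor gr Ab.

Definition part (T : finType) (u : seq T) : FG T ~> FG 'I_(size u) :=
  pm (fun t => [pick i | tnth (in_tuple u) i == t]).

Definition incl (T : finType) (u : seq T) : FG 'I_(size u) ~> FG T :=
  pm (Some \o tnth (in_tuple u)).

Lemma map_tnth_enum (T : eqType) (u : seq T) :
  map (tnth (in_tuple u)) (enum 'I_(size u)) = u.
Proof. by rewrite -[RHS](map_tnth_enum (in_tuple u)). Qed.

Lemma part_on (S T : finType) (u : seq S) (f : S -> T) v : uniq u ->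
  pm (on (map (tnth (in_tuple u)) v) f) = pm (on v (f \o tnth (in_tuple u))) \oo part u.
Proof.
move=> uu; rewrite pm_comp; apply: pm_ext => s; rewrite /on.
have tI : injective (tnth (in_tuple u)) by exact/tuple_uniqP.
case: pickP => [i /eqP <-|ns] /=; first by rewrite mem_map.
by case: mapP => // -[i _ si]; have := ns i; rewrite si eqxx.
Qed.

(** An alternating sum over the subsets of [u] only sees the free factor on [u],
    where it is the projection onto the cross-effect. *)
Lemma Delta_part (S : finType) (Y : gr) (X : gr) (g : FG S ~> Y) (h : X ~> FG S) (u : seq S) x :
  uniq u ->
  Delta u (fun v => act F (g \oo fkill v \oo h) x) =
  act F (g \oo incl u) (eps F _ (act F (part u \oo h) x)).
Proof.
move=> uu; rewrite -{1}(map_tnth_enum u) Delta_map.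
rewrite epsE raddf_Delta; apply: Delta_eq => v _.
rewrite -!act_gcomp -!gcompA; congr (act F (g \oo _) x).
rewrite part_on // !gcompA; congr (_ \oo _ \oo _).
rewrite pm_comp; apply: pm_ext => i; by rewrite /on; case: ifP.
Qed.

(** The decomposition of [F (FG T)] as the direct sum of the cross-effects of the
    subsets of [T]. *)
Lemma decompose (T : finType) (z : (F (FG T) : zmodType)) :
  z = \sum_(u <- subs (enum T)) act F (incl u) (eps F _ (act F (part u) z)).
Proof.
rewrite -[LHS]act_fkill_enum (sum_Delta (enum T) (fun v => act F (fkill v) z)).
rewrite [LHS]big_seq_cond [RHS]big_seq_cond; apply: eq_bigr => u; rewrite andbT mem_subs => su.
have uu : uniq u by exact: subseq_uniq su (enum_uniq T).
transitivity (Delta u (fun v => act F (idfun \oo fkill v \oo idfun) z)).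
  by apply: Delta_eq => v _; congr (act F _ z); exact: ghom_eq.
by rewrite Delta_part // act_gcomp act_id; congr (act F _ (eps F _ (act F _ z))); exact: ghom_eq.
Qed.

End Detect.

Lemma free_retract (X : gr) : exists (T : finType) (i : X ~> FG T) (r : FG T ~> X),
  r \oo i = idfun.
Proof.
have [T [b bP]] := svalP X.
have [i [iP _]] := bP (sval (FG T)) (@gen T).
exists T, i, (lift b); have [phi [_ uniq_phi]] := bP (sval X) b.
rewrite -(uniq_phi idfun) // (uniq_phi (lift b \oo i)) // => x.
by rewrite gcompE iP lift_gen.
Qed.

Lemma zmod_inj0 (U V : zmodType) (f : {additive U -> V}) :
  (forall x, f x = 0 -> x = 0) -> injective f.
Proof.
by move=> f0 x y E; apply/eqP; rewrite -subr_eq0; apply/eqP/f0; rewrite raddfB /= E subrr.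
Qed.

(** The decomposition into cross-effects is natural, hence a transformation which is
    bijective on cross-effects is so on free groups, and on their retracts. *)
Lemma nt_bij (F G : functor gr Ab) (a : nat_trans F G) :
  (forall n, is_bij (@cr_map F G a n)) -> forall X, is_bij (nt_app a X).
Proof.
move=> ab.
have abT T : is_bij (nt_app a (FG T)).
  split=> [|w].
    apply: zmod_inj0 => z az; rewrite [z]decompose big1 // => u _.
    suff -> : eps F _ (act F (part u) z) = 0 by rewrite raddf0.
    pose c : cr F (size u) := subz_mk (@cross0 F _) (@crossB F _) (eps_cross (act F (part u) z)).
    suff c0 : c = 0 by rewrite -[LHS]/(cr_val F _ c) c0 raddf0.
    apply: (proj1 (ab (size u))); rewrite raddf0; apply: cr_eq; rewrite cr_mapE raddf0.
    by rewrite /cr_val /c /= -[LHS]/(nt_app a _ (eps F _ (act F (part u) z))) nt_eps nt_act az !raddf0.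
  pose c u : cr G (size u) := subz_mk (@cross0 G _) (@crossB G _) (eps_cross (act G (part u) w)).
  have /(_ _)/cid d u := proj2 (ab (size u)) (c u).
  exists (\sum_(u <- subs (enum T)) act F (incl u) (cr_val F _ (sval (d u)))).
  rewrite raddf_sum [RHS]decompose; apply: eq_bigr => u _.
  by rewrite nt_act -cr_mapE (svalP (d u)).
move=> X; have [T [i [r ri]]] := free_retract X.
have retr (H : functor gr Ab) x : act H r (act H i x) = x by rewrite -act_gcomp ri act_id.
split=> [x y E|y].
  rewrite -(retr F x) -(retr F y); congr (act F r _).
  by apply: (proj1 (abT T)); rewrite !nt_act E.
have [x ax] := proj2 (abT T) (act G i y).
by exists (act F r x); rewrite nt_act ax retr.
Qed.

Lemma nat_trans_bij_iso (F G : functor gr Ab) (a : nat_trans F G) :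
  (forall X, is_bij (nt_app a X)) -> @is_iso (functor_cat gr Ab) F G a.
Proof.
by move=> ab; apply: nat_trans_iso => X; apply: ab_iso; exact: ab.
Qed.

Lemma Phi_reflects_iso n (F G : Pol n) (a : hom F G) :
  (forall m, is_bij (@cr_map (sval F) (sval G) a m)) -> is_iso a.
Proof. by move=> /nt_bij/nat_trans_bij_iso. Qed.

(** * From pseudo-Mackey functors to functors *)

Section NaturalFamilies.
Variables (M : janus) (X : gr).
Implicit Types (a b : fam M X).

(** The conditions under which [th], extended linearly to [Z[gr(X, FG m)]] and
    restricted to the cross-effects, is a morphism of Janus functors: it vanishes on
    the degenerate part of [Z[gr(X, FG m)]], so that one may replace
    the cross-effect by the corresponding quotient, and it is compatible with the
    upper and the lower maps.  The alternating sum in [nf_low] comes from lifting a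
    class of the quotient to the cross-effect. *)
Record natural_fam (th : fam M X) : Prop := NaturalFam {
  nf_kill : forall m i (h : X ~> FG 'I_m), fkill (others i) \oo h = h -> th m h = 0;
  nf_up : forall n m (phi : osurj n m) h, th n (comul phi \oo h) = up M phi (th m h);
  nf_low : forall n m (f : surj n m) h,
    low M f (th n h) = Delta (enum 'I_n) (fun u => th m (pm (on u f) \oo h)) }.

Lemma natural_fam0 : natural_fam 0.
Proof.
split=> // [n m phi h|n m f h]; first by rewrite raddf0.
by rewrite raddf0 Delta_const0.
Qed.

Lemma natural_famB a b : natural_fam a -> natural_fam b -> natural_fam (a - b).
Proof.
move=> [a1 a2 a3] [b1 b2 b3]; split=> [m i h hi|n m phi h|n m f h].
- by rewrite -[LHS]/(a m h - b m h) (a1 _ i) // (b1 _ i) // subrr.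
- by rewrite -[LHS]/(a n _ - b n _) -[(a - b) m h]/(a m h - b m h) raddfB a2 b2.
- by rewrite -[(a - b) n h]/(a n h - b n h) raddfB /= a3 b3 -DeltaN -DeltaD.
Qed.

Definition nfam : zmodType := subz natural_fam0 natural_famB.

Definition ev_fun m (h : X ~> FG 'I_m) (th : nfam) : M m := subz_val _ _ th m h.

Lemma ev_zmod m h : zmod_morphism (@ev_fun m h).
Proof. by move=> a b; rewrite /ev_fun raddfB. Qed.

HB.instance Definition _ m h := GRing.isZmodMorphism.Build _ _ (@ev_fun m h) (@ev_zmod m h).

Definition ev m (h : X ~> FG 'I_m) : {additive nfam -> M m} := @ev_fun m h.

Lemma ev_eq (a b : nfam) : (forall m h, @ev m h a = ev h b) -> a = b.
Proof. by move=> E; apply: subz_eq; apply: fam_eq => m h; exact: E. Qed.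

Lemma ev_kill th m i (h : X ~> FG 'I_m) : fkill (others i) \oo h = h -> ev h th = 0.
Proof. exact: (nf_kill (subz_valP th)). Qed.

Lemma ev_up th n m (phi : osurj n m) h : ev (comul phi \oo h) th = up M phi (ev h th).
Proof. exact: (nf_up (subz_valP th)). Qed.

Lemma ev_low th n m (f : surj n m) h :
  low M f (ev h th) = Delta (enum 'I_n) (fun u => ev (pm (on u f) \oo h) th).
Proof. exact: (nf_low (subz_valP th)). Qed.

Definition nfam_mk (a : fam M X) (na : natural_fam a) : nfam := subz_mk _ _ na.

Lemma ev_mk (a : fam M X) (na : natural_fam a) m h : ev h (nfam_mk na) = a m h.
Proof. by []. Qed.

End NaturalFamilies.

Arguments ev {M X m} h.

Section FamilyFunctor.
Variable M : janus.

Lemma precomp_natural (X Y : gr) (u : X ~> Y) (th : nfam M X) :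
  natural_fam (M := M) (fun m (h : Y ~> FG 'I_m) => ev (h \oo u) th).
Proof.
split=> [m i h hi|n m phi h|n m f h].
- by apply: (@ev_kill _ _ _ _ i); rewrite gcompA hi.
- by rewrite -gcompA ev_up.
- by rewrite ev_low; apply: Delta_eq => v _; rewrite gcompA.
Qed.

Definition precomp_fun (X Y : gr) (u : X ~> Y) (th : nfam M X) : nfam M Y :=
  nfam_mk (precomp_natural u th).

Lemma ev_precomp_fun (X Y : gr) (u : X ~> Y) th m (h : Y ~> FG 'I_m) :
  ev h (precomp_fun u th) = ev (h \oo u) th.
Proof. by []. Qed.

Lemma precomp_zmod X Y u : zmod_morphism (@precomp_fun X Y u).
Proof. by move=> a b; apply: ev_eq => m h; rewrite raddfB /= !ev_precomp_fun raddfB. Qed.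

HB.instance Definition _ X Y u :=
  GRing.isZmodMorphism.Build _ _ (@precomp_fun X Y u) (@precomp_zmod X Y u).

Definition precomp (X Y : gr) (u : X ~> Y) : {additive nfam M X -> nfam M Y} :=
  @precomp_fun X Y u.

Lemma precomp1 (X : gr) : precomp (idfun : X ~> X) = idfun.
Proof.
apply: additive_eq => th; apply: ev_eq => m h; rewrite [LHS]ev_precomp_fun.
by congr (ev _ th); exact: ghom_eq.
Qed.

Lemma precompM (X Y Z : gr) (v : Y ~> Z) (u : X ~> Y) :
  precomp (v \oo u) = precomp v \o precomp u.
Proof.
apply: additive_eq => th; apply: ev_eq => m h.
by rewrite -[RHS]/(ev (h \oo v \oo u) th) [LHS]ev_precomp_fun gcompA.
Qed.

Definition Psi_fun : functor gr Ab :=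
  @Functor gr Ab (fun X => nfam M X) (@FunctorOn gr Ab (fun X => nfam M X)
    precomp precomp1 precompM).

Lemma ev_act (X Y : gr) (u : X ~> Y) (th : nfam M X) m (h : Y ~> FG 'I_m) :
  ev h (act Psi_fun u th) = ev (h \oo u) th.
Proof. by []. Qed.

End FamilyFunctor.

Section FamilyMorphism.
Variables (M N : janus) (s : janus_hom M N).

Lemma postcomp_natural (X : gr) (th : nfam M X) :
  natural_fam (M := N) (fun m (h : X ~> FG 'I_m) => s m (ev h th)).
Proof.
split=> [m i h hi|n m phi h|n m f h].
- by rewrite (ev_kill _ hi) raddf0.
- by rewrite ev_up jfun_up.
- by rewrite -jfun_low ev_low raddf_Delta.
Qed.

Definition postcomp_fun (X : gr) (th : nfam M X) : nfam N X := nfam_mk (postcomp_natural th).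

Lemma ev_postcomp_fun (X : gr) th m (h : X ~> FG 'I_m) :
  ev h (postcomp_fun th) = s m (ev h th).
Proof. by []. Qed.

Lemma postcomp_zmod X : zmod_morphism (@postcomp_fun X).
Proof.
move=> a b; apply: ev_eq => m h; rewrite [RHS]raddfB !ev_postcomp_fun [ev _ _]raddfB [LHS]raddfB.
by [].
Qed.

HB.instance Definition _ X :=
  GRing.isZmodMorphism.Build _ _ (@postcomp_fun X) (@postcomp_zmod X).

Definition postcomp (X : gr) : {additive nfam M X -> nfam N X} := @postcomp_fun X.

Lemma postcomp_nat (X Y : gr) (f : @hom gr X Y) :
  cmp (postcomp Y : @hom Ab _ _) (fmap (fmor (Psi_fun M)) f) =
  cmp (fmap (fmor (Psi_fun N)) f) (postcomp X : @hom Ab _ _).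
Proof. by apply: additive_eq => th; apply: ev_eq. Qed.

Definition Psi_nat : nat_trans (Psi_fun M) (Psi_fun N) :=
  @NatTrans gr Ab (Psi_fun M) (Psi_fun N) (fun X => postcomp X) postcomp_nat.

End FamilyMorphism.

(** ** The functor of natural families is polynomial *)

Section FamilyPolynomial.
Variables (n : nat) (M : janus).
Hypotheses (M0 : ab_zero (M 0)) (Mn : forall m, (n < m)%N -> ab_zero (M m)).

Lemma ev_degenerate (X : gr) (th : nfam M X) (S : finType) m (f : S -> 'I_m) u (h : X ~> FG S) i :
  (forall x, x \in u -> f x != i) -> ev (pm (on u f) \oo h) th = 0.
Proof.
move=> ui; apply: (@ev_kill _ _ _ _ i); rewrite gcompA pm_on_comp; congr (_ \oo _).
congr pm; apply: on_ext => x; rewrite mem_filter mem_others.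
by apply/andP/idP => [[]//|xu]; split=> //; exact: ui.
Qed.

(** The alternating sum is the image under [M_*] of an element of [M (size u)], by
    [nf_low] applied to the component of [h] on the free factor on [u]. *)
Lemma ev_Delta0 (X : gr) (th : nfam M X) (S : finType) m (f : S -> 'I_m) (h : X ~> FG S) u :
  uniq u -> (n < size u)%N -> Delta u (fun v => ev (pm (on v f) \oo h) th) = 0.
Proof.
move=> uu nu; pose g := f \o tnth (in_tuple u).
have [gS|] := pselect (surj_fun g); last first.
  move=> /existsNP[i ng]; apply: Delta_eq0 => v vu; apply: (@ev_degenerate _ _ _ _ _ _ _ i) => x xv.
  apply/eqP => fx; apply: ng.
  have /tnthP[j xj] : x \in in_tuple u by exact: (mem_subseq vu).
  by exists j; rewrite /g /= -xj.
have <- : low M (Surj gS) (ev (part u \oo h) th) = 0 by rewrite (Mn nu (ev _ _)) raddf0.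
rewrite ev_low -[in LHS](map_tnth_enum u) Delta_map; apply: Delta_eq => v _.
by rewrite part_on // gcompA.
Qed.

Lemma Psi_reduced : reduced (Psi_fun M).
Proof.
move=> X X1 th; apply: ev_eq => m h; rewrite raddf0.
case: m h => [|m] h; first exact: M0.
apply: (@ev_kill _ _ _ _ ord0); apply: ghom_eq => x.
by rewrite gcompE (X1 x) !gmulf1.
Qed.

(** A morphism out of a coproduct of [n+1] groups is the codiagonal of [n+1] copies
    of the target composed with a coproduct of morphisms.  Let [t u] be the value of the
    family once the generators of the copies outside [u] are killed.  It vanishes when
    [u] misses one of the copies, because the family is in the cross-effect; otherwise
    [u] has more than [n] elements and [t u] is, up to values at smaller
    sets, an alternating sum that vanishes by [ev_Delta0]. *)
Lemma Psi_polynomial : polynomial_le n (Psi_fun M).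
Proof.
move=> X th cth; apply: ev_eq => k h; rewrite raddf0.
pose S : finType := ('I_n.+1 * 'I_k)%type.
pose h' : vee X ~> FG S := vee_case (fun i : 'I_n.+1 =>
   (pm (fun j => Some (i, j)) \oo (h \oo vee_in X i) : hom (X i) (FG S))).
have h'E i x : h' (vee_in X i x) = pm (fun j => Some (i, j)) (h (vee_in X i x)).
  exact: (congr1 (fun g : hom (X i) (FG S) => g x) (vee_caseK _ i)).
pose t u := ev (pm (on u (snd : S -> 'I_k)) \oo h') th.
have t_missing u i : (forall j, (i, j) \notin u) -> t u = 0.
  move=> iu.
  pose g : vee_omit X i ~> FG S := vee_case (fun j : {j : 'I_n.+1 | j != i} =>
     (pm (fun l => Some (val j, l)) \oo (h \oo vee_in X (val j)) : hom (X (val j)) (FG S))).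
  rewrite /t; have -> : pm (on u (snd : S -> 'I_k)) \oo h' =
     pm (on u (snd : S -> 'I_k)) \oo g \oo vee_kill X i.
    apply: fprod_hom_eq => j x; rewrite -[fprod_in _ _ _]/(vee_in X j x) !gcompE h'E.
    have [ji|ji] := eqVneq j i.
      move: x; rewrite ji => x; rewrite vee_kill_same !gmulf1.
      rewrite -[LHS]/((pm (on u snd) \oo pm (fun l => Some (i, l))) (h (vee_in X i x))).
      rewrite pm_comp (_ : pm _ = one_fun _ :> {ghom _ -> _}) //.
      by apply: free_eq => l; rewrite pm_gen /= /on (negPf (iu l)).
    rewrite (vee_kill_other ji); congr (pm _ _).
    by rewrite /g [RHS](@vee_case_in _ (fun l : {l : 'I_n.+1 | l != i} => X (val l)) (FG S)
      (fun j => pm (fun l => Some (val j, l)) \oo (h \oo vee_in X (val j))) (exist _ j ji) x).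
  have := congr1 (ev (pm (on u (snd : S -> 'I_k)) \oo g)) (cth i).
  by rewrite raddf0 => <-.
have -> : ev h th = t (enum S).
  congr (ev _ th); apply: fprod_hom_eq => i x; rewrite -[fprod_in _ _ _]/(vee_in X i x) gcompE h'E.
  rewrite -[RHS]/((pm (on (enum S) (snd : S -> 'I_k)) \oo pm (fun l => Some (i, l))) (h (vee_in X i x))).
  by rewrite on_enum pm_comp pm_some.
suff t0 p : forall u, (size u < p)%N -> uniq u -> t u = 0 by apply: t0 (ltnSn _) (enum_uniq S).
elim: p => // p IH u; rewrite ltnS => up uu.
have [[i iu]|ex_u] := pselect (exists i, forall j, (i, j) \notin u); first exact: t_missing iu.
have nu : (n < size u)%N.
  rewrite -(size_map fst); apply: leq_trans (_ : size (enum 'I_n.+1) <= _)%N; first by rewrite size_enum_ord.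
  apply: uniq_leq_size (enum_uniq _) _ => i _; apply: contrapT => iu.
  by apply: ex_u; exists i => j; apply/negP => /(map_f fst).
rewrite -(Delta_top (G := t) (s := u)); first exact: ev_Delta0.
move=> v vu nvu; have su := size_subseq vu.
apply: IH (subseq_uniq vu uu); apply: leq_trans up.
by rewrite ltn_neqAle su andbT (size_subseq_leqif vu).2.
Qed.

End FamilyPolynomial.

Section FamilyFunctorOb.
Variable n : nat.

Definition Psi_ob (M : PMack_le n) : Pol n :=
  exist _ (Psi_fun (sval (sval M)))
    (conj (Psi_reduced (proj1 (svalP M))) (Psi_polynomial (proj2 (svalP M)))).

Definition Psi_mor (M N : PMack_le n) (s : hom M N) : hom (Psi_ob M) (Psi_ob N) :=
  Psi_nat (s : janus_hom (sval (sval M)) (sval (sval N))).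

Lemma Psi_id (M : PMack_le n) : Psi_mor (idm M) = idm (Psi_ob M).
Proof. by apply: nat_trans_eq => X; apply: additive_eq => th; apply: ev_eq. Qed.

Lemma Psi_comp (M N P : PMack_le n) (t : hom N P) (s : hom M N) :
  Psi_mor (cmp t s) = cmp (Psi_mor t) (Psi_mor s).
Proof. by apply: nat_trans_eq => X; apply: additive_eq => th; apply: ev_eq. Qed.

Definition Psi : functor (PMack_le n) (Pol n) := Functor (FunctorOn Psi_id Psi_comp).

End FamilyFunctorOb.

(** * Tuples of elements of a free group *)

Section Tuples.
Variables r k : nat.
Local Notation L := ('I_r * 'I_k)%type.

Definition coord (j : 'I_r) : FG L ~> FG 'I_k :=
  pm (fun l : L => if l.1 == j then Some l.2 else None).

(** Any element of the free group on pairs yields a tuple of elements of [FG 'I_k],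
    and all tuples arise ([tuple_hom_flat]); functions of tuples are thereby functions
    on a single free group, on which one can argue by induction on words. *)
Definition tuple_hom (g : (sval (FG L) : groupType)) : FG 'I_r ~> FG 'I_k :=
  lift (fun j => coord j g).

Definition flat (h : FG 'I_r ~> FG 'I_k) : (sval (FG L) : groupType) :=
  (\prod_(j <- enum 'I_r) pm (fun i => Some (j, i) : option L) (h (gen j)))%g.

Lemma prod_single (G : groupType) (T : eqType) (s : seq T) j (F : T -> G) : uniq s ->
  (forall i, i != j -> F i = 1%g) -> (\prod_(i <- s) F i)%g = if j \in s then F j else 1%g.
Proof.
move=> us Fj; elim: s us => [|x s IH] /=; first by rewrite big_nil.
move=> /andP[xs us]; rewrite big_cons IH // inE eq_sym.
have [xj|xj] /= := eqVneq x j; last by rewrite Fj // mul1g.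
by rewrite -xj (negPf xs) mulg1.
Qed.

Lemma coord_flat h j : coord j (flat h) = h (gen j).
Proof.
rewrite /flat gmulf_prod (@prod_single _ _ _ j) ?enum_uniq //.
  rewrite mem_enum -gcompE pm_comp /= -[RHS]pm_some; congr (pm _ _).
  by apply/funext => i; rewrite /= eqxx.
move=> i ij; rewrite -gcompE pm_comp /= (_ : pm _ = one_fun _ :> {ghom _ -> _}) //.
by apply: free_eq => l; rewrite pm_gen /= (negPf ij).
Qed.

Lemma tuple_hom_flat h : tuple_hom (flat h) = h.
Proof. by apply: free_eq => j; rewrite lift_gen coord_flat. Qed.

End Tuples.

(** * The counit *)

Section CounitInjective.
Variables (n : nat) (M : janus).
Hypothesis Mn : forall m, (n < m)%N -> ab_zero (M m).
Variables (r k : nat) (th : nfam M (FG 'I_r)).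
Hypothesis th_cross : cross (F := Psi_fun M) th.
Hypothesis th_id : ev (idfun : FG 'I_r ~> FG 'I_r) th = 0.

Local Notation L := ('I_r * 'I_k)%type.

Definition tuple_ev (g : (sval (FG L) : groupType)) : M k := ev (tuple_hom g) th.

(** As [v] varies this is the full Taylor expansion of [tuple_ev] at [g]. *)
Definition diff (g : (sval (FG L) : groupType)) (v : seq L) : M k :=
  Delta v (fun u => tuple_ev (g * gword u)%g).

Lemma diff_gen g l v : diff (g * gen l)%g v = diff g v + diff g (l :: v).
Proof.
rewrite addrC /diff /= subrK; apply: Delta_eq => u _.
by rewrite /gword big_cons mulgA.
Qed.

(** The element [tuple_hom (g * gword u)], for [u] a sublist of [v], is obtained from
    one morphism into the free group on [k] generators and the positions of [v], by
    killing the positions outside [u] and then mapping the positions to their letters.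
    So [ev_Delta0] applies, at the base point formed by the [k] generators. *)
Lemma diff_big g v : (n < size v)%N -> diff g v = 0.
Proof.
move=> nv; pose V := tnth (in_tuple v); pose N := size v.
pose T : finType := ('I_k + 'I_N)%type.
pose f (t : T) := match t with inl i => i | inr a => (V a).2 end.
pose h' : FG 'I_r ~> FG T := lift (fun j =>
  pm (fun i => Some (inl i : T)) (coord k j g) *
  gword [seq (inr a : T) | a <- enum 'I_N & (V a).1 == j])%g.
pose z : seq T := [seq inl i | i <- enum 'I_k].
pose t u := ev (pm (on u f) \oo h') th.
transitivity (Delta [seq (inr a : T) | a <- enum 'I_N] (fun u => t (z ++ u))).
  rewrite /diff -[in LHS](map_tnth_enum v) [LHS]Delta_map [RHS]Delta_map; apply: Delta_eq => A sA.
  rewrite /t /tuple_ev; congr (ev _ th); apply: free_eq => j.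
  rewrite gcompE !lift_gen !gmulfM; congr (_ * _)%g.
    rewrite pm_compE -[LHS]pm_some; congr (pm _ _); apply/funext => i.
    by rewrite /= /on mem_cat map_f ?mem_enum.
  rewrite !pm_gword pmap_on filter_map -map_comp.
  rewrite (@eq_filter _ _ (mem A)); last first.
    move=> a; rewrite /= mem_cat mem_map; last by move=> ? ? [].
    by case: mapP => [[i _ e]|_ /=]; first by discriminate e.
  rewrite filter_swap -(subseq_uniqP (enum_uniq _) sA).
  congr gword; elim: A {sA} => //= a A IH; rewrite -/V; case: eqP => //= _; by rewrite IH.
apply: (@Delta_shift _ _ n t).
- by move=> u w uw; rewrite /t (on_ext _ uw).
- by move=> s us ns; apply: (ev_Delta0 Mn).
- rewrite cat_uniq; apply/and3P; split; first by rewrite map_inj_uniq ?enum_uniq // => ? ? [].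
    by apply/hasPn => _ /mapP[a _ ->]; apply/mapP => -[].
  by rewrite map_inj_uniq ?enum_uniq // => ? ? [].
- by rewrite size_map size_enum_ord.
Qed.

(** At the identity all the elements under consideration are positive words: by
    [nf_low] the difference is the image under [M_*] of the value at a
    comultiplication, which is the image under [M^*] of the value at the identity. *)
Lemma diff_one v : diff 1%g v = 0.
Proof.
pose V := tnth (in_tuple v); pose N := size v.
pose p a := (V a).1; pose f a := (V a).2.
pose d : FG 'I_r ~> FG 'I_N := lift (fun j => gword (fibre p j)).
have dth : ev d th = 0.
  have [pS|] := pselect (surj_fun p).
    have -> : d = comul (pos_osurj (Surj pS)) \oo idfun.
      by apply: free_eq => j; rewrite lift_gen gcompE comul_gen ofibre_pos.
    by rewrite ev_up th_id raddf0.
  move=> /existsNP[j nj]; have -> : d = d \oo fkill (others j).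
    apply: free_eq => i; rewrite gcompE pm_gen /on mem_others.
    case: eqP => [->|_] //=; rewrite gmulf1 lift_gen (_ : fibre _ _ = [::]) ?/gword ?big_nil //.
    apply/eqP; rewrite -(negbK (_ == _)) -has_filter; apply/hasPn => a _.
    by apply/eqP => pa; apply: nj; exists a.
  by rewrite -ev_act th_cross raddf0.
transitivity (Delta (enum 'I_N) (fun A => ev (pm (on A f) \oo d) th)).
  rewrite /diff -[in LHS](map_tnth_enum v) Delta_map; apply: Delta_eq => A sA.
  rewrite mul1g /tuple_ev; congr (ev _ th); apply: free_eq => j.
  rewrite gcompE !lift_gen !pm_gword pmap_on.
  rewrite filter_swap -(subseq_uniqP (enum_uniq _) sA).
  congr gword; elim: A {sA} => //= a A IH; rewrite /p -/V; case: eqP => //= _; by rewrite IH.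
have [fS|] := pselect (surj_fun f).
  by rewrite -(ev_low th (Surj fS)) dth raddf0.
move=> /existsNP[i nf]; apply: Delta_eq0 => A _; apply: (@ev_degenerate _ _ _ _ _ _ _ _ i) => a _.
by apply/eqP => fa; apply: nf; exists a.
Qed.

(** The expansions at [g] and at [g * gen l] determine each other, by descending
    induction on the length starting from the vanishing in length [n+1]. *)
Lemma diff_eq0 g v : (size v <= n.+1)%N -> diff g v = 0.
Proof.
move: g v; apply: free_ind => [v _|g l]; first exact: diff_one.
split=> D v; last first.
  have [m] := ubnP (n.+1 - size v)%N; elim: m v => // m IH v; rewrite ltnS => vm vn.
  have := D v vn; rewrite diff_gen.
  have [vn'|nv] := leqP (size v) n; last by rewrite (diff_big _ nv).
  by rewrite (IH (l :: v)) ?addr0 //=; rewrite subSS -subSn.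
move=> vn; rewrite diff_gen D // add0r.
have [vn'|nv] := leqP (size v) n; first exact: D.
by rewrite diff_big //= leqW.
Qed.

Lemma ev_eq0 (h : FG 'I_r ~> FG 'I_k) : ev h th = 0.
Proof. by have := @diff_eq0 (flat h) [::] isT; rewrite /diff /= /gword big_nil mulg1 /tuple_ev tuple_hom_flat. Qed.

End CounitInjective.

(** ** The group of bijections of a type *)

Section Bijections.
Variable T : Type.

Definition bij := {f : T -> T | is_bij f}.

HB.instance Definition _ := gen_eqMixin bij.
HB.instance Definition _ := gen_choiceMixin bij.

Lemma bij_eq (f g : bij) : sval f =1 sval g -> f = g.
Proof. by case: f g => [f fP] [g gP] /= /funext E; apply: eq_exist. Qed.

Lemma is_bij_id : is_bij (@id T).
Proof. by split=> // y; exists y. Qed.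

Lemma is_bij_comp (f g : bij) : is_bij (sval g \o sval f).
Proof.
case: f g => [f [fI fS]] [g [gI gS]]; split=> [|z]; first exact: inj_comp.
by have [y <-] := gS z; have [x <-] := fS y; exists x.
Qed.

Lemma is_bij_sym (f : bij) : is_bij (sval (cid (is_bij_inv (svalP f)))).
Proof.
case: cid => g /= [fK gK]; split=> [|y]; first exact: can_inj gK.
by exists (sval f y).
Qed.

Definition bij1 : bij := exist _ id is_bij_id.
(** The left factor is applied first: the letters of a word act from left to right. *)
Definition bijM (f g : bij) : bij := exist _ (sval g \o sval f) (is_bij_comp f g).
Definition bijV (f : bij) : bij := exist _ _ (is_bij_sym f).

Lemma bijA : associative bijM. Proof. by move=> f g h; apply: bij_eq. Qed.
Lemma bij1M : left_id bij1 bijM. Proof. by move=> f; apply: bij_eq. Qed.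
Lemma bijM1 : right_id bij1 bijM. Proof. by move=> f; apply: bij_eq. Qed.
Lemma bijVM : left_inverse bij1 bijV bijM.
Proof. by move=> f; apply: bij_eq => x /=; case: cid => g /= [_ ->]. Qed.
Lemma bijMV : right_inverse bij1 bijV bijM.
Proof. by move=> f; apply: bij_eq => x /=; case: cid => g /= [-> _]. Qed.

HB.instance Definition _ := isGroup.Build bij bijA bij1M bijM1 bijVM bijMV.

End Bijections.

(** ** The action of a free group on functions of words *)

Section Shift.
Variables (n : nat) (L : finType) (A : zmodType).
Implicit Types (l : L) (v : seq L) (e : seq L -> A).

(** The operator [1 + X_l] where [X_l] is the transpose of left multiplication by
    the letter [l], cut off at length [n] so as to be nilpotent. *)
Definition shift l e v : A := e v + if (size v < n)%N then e (l :: v) else 0.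

Fixpoint unshift_rec k l e v : A :=
  if k is k'.+1 then e v - unshift_rec k' l e (l :: v) else e v.

Definition unshift l e v : A := unshift_rec (n - size v) l e v.

Lemma unshiftK l e : shift l (unshift l e) = e.
Proof.
apply/funext => v; rewrite /shift /unshift; case: ltnP => [vn|]; last first.
  by rewrite -subn_eq0 => /eqP->; rewrite addr0.
by rewrite -(subnSK vn) /= subrK.
Qed.

Lemma shift_eq0 l e : (forall v, shift l e v = 0) -> forall v, e v = 0.
Proof.
move=> E v; have [m] := ubnP (n - size v)%N; elim: m v => // m IH v.
rewrite ltnS => vm; have := E v; rewrite /shift; case: ltnP => [vn|_]; last by rewrite addr0.
by rewrite (IH (l :: v)) ?addr0 //= (subnSK vn).
Qed.

Lemma shiftB l e e' v : shift l (fun w => e w - e' w) v = shift l e v - shift l e' v.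
Proof. by rewrite /shift; case: ifP => _; rewrite ?addr0 // opprD addrACA. Qed.

Lemma shift_inj l : injective (shift l).
Proof.
move=> e e' E; apply/funext => v; apply/eqP; rewrite -subr_eq0; apply/eqP.
by apply: (@shift_eq0 l (fun w => e w - e' w)) => w; rewrite shiftB E subrr.
Qed.

Lemma shift_bij l : is_bij (shift l).
Proof. by split=> [|e]; [exact: shift_inj | exists (unshift l e); exact: unshiftK]. Qed.

Definition rho : {ghom (sval (FG L) : groupType) -> bij (seq L -> A)} :=
  lift (fun l => exist _ (shift l) (shift_bij l) : bij (seq L -> A)).

(** Evaluated at the empty word, this is the pairing of [e] with the Magnus expansion
    of [g] truncated at degree [n]. *)
Definition magnus (g : (sval (FG L) : groupType)) e : seq L -> A := sval (rho g) e.

Lemma magnus1 e : magnus 1%g e = e.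
Proof. by rewrite /magnus gmulf1. Qed.

Lemma magnusM g h e : magnus (g * h)%g e = magnus h (magnus g e).
Proof. by rewrite /magnus gmulfM. Qed.

Lemma magnus_gen l e : magnus (gen l) e = shift l e.
Proof. by rewrite /magnus lift_gen. Qed.

Lemma magnusB g e e' : magnus g (fun w => e w - e' w) = (fun w => magnus g e w - magnus g e' w).
Proof.
elim/free_ind: g => [|g l]; first by rewrite !magnus1.
rewrite !magnusM !magnus_gen; have -> : (fun w => shift l (magnus g e) w - shift l (magnus g e') w) =
  shift l (fun w => magnus g e w - magnus g e' w) by apply/funext => w; rewrite shiftB.
by split=> [->|/shift_inj].
Qed.

Lemma magnus0 g : magnus g (fun=> 0) = (fun=> 0).
Proof.
have := magnusB g (fun=> 0) (fun=> 0); rewrite subrr => ->.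
by apply/funext => w; rewrite subrr.
Qed.

Lemma magnus_Delta g (S : eqType) (s : seq S) (G : seq S -> seq L -> A) :
  magnus g (fun w => Delta s (fun u => G u w)) = (fun w => Delta s (fun u => magnus g (G u) w)).
Proof. by elim: s G => //= x s IH G; rewrite magnusB !IH. Qed.

Definition low_degree e := forall v, (n < size v)%N -> e v = 0.

Lemma shift_low l e : low_degree e -> shift l e = fun v => e v + e (l :: v).
Proof.
move=> eW; apply/funext => v; rewrite /shift; case: ltnP => // nv.
by rewrite (eW (l :: v)).
Qed.

Lemma low_degree_shift l e : low_degree (shift l e) <-> low_degree e.
Proof.
by split=> eW v nv; have := eW v nv; rewrite /shift ltnNge (ltnW nv) addr0.
Qed.

Lemma low_degree_magnus g e : low_degree e -> low_degree (magnus g e).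
Proof.
elim/free_ind: g e => [e|g l]; first by rewrite magnus1.
split=> E e /E; rewrite magnusM magnus_gen; first by move/low_degree_shift.
by move/low_degree_shift.
Qed.

(** The coefficient of a word in the Magnus expansion of a positive word counts its
    occurrences as a sublist. *)
Lemma magnus_gword d e v : low_degree e ->
  magnus (gword d) e v = \sum_(c <- subs d) e (c ++ v).
Proof.
elim: d e => [|x d IH] e eW; first by rewrite /gword big_nil magnus1 big_seq1.
rewrite /gword big_cons magnusM magnus_gen IH; last exact/low_degree_shift.
by rewrite big_cat /= big_map -big_split /= shift_low.
Qed.

End Shift.

Arguments magnus n {L A} g e.
Arguments low_degree n {L A} e.

(** A map of words that intertwines the actions of the generators intertwines the
    actions of the groups: generators act by bijections. *)
Lemma magnus_intertwine n (L L' : finType) (A A' : zmodType) (u : FG L ~> FG L')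
    (T : (seq L' -> A) -> (seq L -> A')) :
  (forall l e, low_degree n e -> T (magnus n (u (gen l)) e) = shift n l (T e)) ->
  forall g e, low_degree n e -> T (magnus n (u g) e) = magnus n g (T e).
Proof.
move=> Tu; apply: free_ind => [e _|g l]; first by rewrite gmulf1 !magnus1.
split=> Tg e eW; have := Tg e eW; rewrite gmulfM !magnusM magnus_gen Tu; try exact: low_degree_magnus.
  by move=> ->.
by move/shift_inj.
Qed.

Lemma magnus_raddf n (L : finType) (A A' : zmodType) (f : {additive A -> A'}) g (e : seq L -> A) :
  low_degree n e -> f (magnus n g e [::]) = magnus n g (fun w => f (e w)) [::].
Proof.
move=> eW; pose T (e : seq L -> A) (w : seq L) := f (e w).
rewrite -[RHS]/(magnus n g (T e) [::]) -(@magnus_intertwine n L L A A' idfun T) // => l e' _.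
rewrite magnus_gen; apply/funext => w; rewrite /T /shift raddfD /=.
by case: ifP; rewrite ?raddf0.
Qed.

Section PartialMapAction.
Variables (n : nat) (L L' : finType) (A : zmodType) (f : L -> option L').

Definition pull (e : seq L' -> A) (w : seq L) : A :=
  if all (fun l => f l : bool) w then e (pmap f w) else 0.

Lemma magnus_pm g e : low_degree n e -> magnus n (pm f g) e [::] = magnus n g (pull e) [::].
Proof.
move=> eW; rewrite -(@magnus_intertwine n L L' A A (pm f) pull) // => l e' _.
apply/funext => w; rewrite pm_gen /shift /pull /=.
case: (f l) => [l'|] /=; last by rewrite magnus1 if_same addr0.
rewrite magnus_gen /shift; case: ifP => [fw|]; last by rewrite if_same addr0.
by rewrite size_pmap; move: fw; rewrite all_count => /eqP->.
Qed.

End PartialMapAction.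

Section WordMapAction.
Variables (n : nat) (L L' : finType) (A : zmodType) (D : L -> seq L').

(** Transpose of the substitution [X_l |-> (1 + X_(l1)) ... (1 + X_(lp)) - 1], where
    [D l] is the word [l1 ... lp]. *)
Fixpoint blocks (v : seq L) (e : seq L' -> A) : A :=
  if v is l :: v' then \sum_(c <- subs (D l) | c != [::]) blocks v' (fun u => e (c ++ u))
  else e [::].

Lemma blocks_sum v (I : Type) (s : seq I) (P : pred I) (E : I -> seq L' -> A) :
  blocks v (fun u => \sum_(i <- s | P i) E i u) = \sum_(i <- s | P i) blocks v (E i).
Proof.
elim: v E => //= l v IH E; rewrite exchange_big /=; apply: eq_bigr => c _.
exact: (IH (fun i u => E i (c ++ u))).
Qed.

Lemma blocks_eq0 v e :
  (forall u, {subset u <= flatten (map D v)} -> (size v <= size u)%N -> e u = 0) -> blocks v e = 0.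
Proof.
elim: v e => [|l v IH] e E /=; first exact: E.
rewrite big_seq_cond big1 // => c /andP[]; rewrite mem_subs => sc c0.
apply: IH => u su vu; apply: E => [x|].
  by rewrite !mem_cat => /orP[/(mem_subseq sc)->//|/su ->]; rewrite orbT.
by rewrite size_cat /= -[(size v).+1]add1n leq_add // lt0n size_eq0.
Qed.

Lemma low_degree_blocks e : low_degree n e -> low_degree n (fun v => blocks v e).
Proof.
by move=> eW v nv; apply: blocks_eq0 => u _ vu; apply: eW; exact: leq_trans vu.
Qed.

Lemma sum_subs_nil (B : zmodType) (s : seq L') (E : seq L' -> B) :
  \sum_(c <- subs s) E c = E [::] + \sum_(c <- subs s | c != [::]) E c.
Proof.
elim: s => [|x s IH]; first by rewrite big_seq1 big_cons big_nil addr0.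
by rewrite /= !big_cat /= IH -addrA; congr (_ + (_ + _)); rewrite !big_map.
Qed.

Definition word_hom : FG L ~> FG L' := lift (fun l => gword (D l)).

Lemma magnus_word_hom g e : low_degree n e ->
  magnus n (word_hom g) e [::] = magnus n g (fun v => blocks v e) [::].
Proof.
move=> eW; pose T (e : seq L' -> A) (v : seq L) := blocks v e.
rewrite -[RHS]/(magnus n g (T e) [::]).
rewrite -(@magnus_intertwine n L L' A A word_hom T) // => l {eW}e eW.
rewrite (shift_low _ (low_degree_blocks eW)); apply/funext => v.
rewrite lift_gen /T /=.
have -> : magnus n (gword (D l)) e = fun v => \sum_(c <- subs (D l)) e (c ++ v).
  by apply/funext => w; rewrite magnus_gword.
by rewrite blocks_sum sum_subs_nil.
Qed.

Lemma sum_subs_cat (T : eqType) (s t : seq T) (E : seq T -> A) :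
  \sum_(u <- subs (s ++ t)) E u = \sum_(c <- subs s) \sum_(u <- subs t) E (c ++ u).
Proof.
elim: s E => [|x s IH] E; first by rewrite big_seq1.
by rewrite /= !big_cat /= !big_map !IH.
Qed.

(** When the blocks carry distinct labels, a choice of nonempty sublists is a
    sublist of the labelled concatenation which meets all the labels. *)
Lemma blocks_labelled (C : eqType) (zz : seq (C * L)) e : uniq (map fst zz) ->
  blocks (map snd zz) e =
  \sum_(U <- subs (flatten [seq [seq (x.1, y) | y <- D x.2] | x <- zz]))
     if all (mem (map fst U)) (map fst zz) then e (map snd U) else 0.
Proof.
elim: zz e => [|[i l] zz IH] e /=; first by rewrite big_seq1.
move=> /andP[izz uzz]; rewrite sum_subs_cat subs_map big_map.
rewrite [RHS](bigID (fun c => c != [::])) /= [X in _ = _ + X]big1 ?addr0; last first.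
  move=> c; rewrite negbK => /eqP-> /=; rewrite big_seq big1 // => U.
  rewrite mem_subs => /mem_subseq sU; case: ifP => // /andP[/mapP[x /sU xU ix]].
  case/flatten_mapP: xU => z zzz /mapP[y _ xz] _.
  by case/negP: izz; rewrite ix xz; apply/mapP; exists z.
apply: eq_bigr => c c0; rewrite IH //; apply: eq_bigr => U _.
rewrite !map_cat -!map_comp /= mem_cat.
have -> : i \in map (fst \o pair i) c.
  by case: c c0 => // x c _; rewrite /= mem_head.
have -> : map (snd \o pair i) c = c by rewrite map_id_in.
rewrite /=; congr (if _ then _ else _); apply: eq_in_all => j jzz /=.
rewrite mem_cat orb_idl // => /mapP[x _ /= ji].
by move: izz; rewrite -ji jzz.
Qed.

End WordMapAction.

(** ** Brackets of words *)

Section Brackets.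
Variables (M : janus) (r : nat) (y : M r).

(** The pair of legs of [u] is a span between ['I_r] and ['I_k], along which [y] is
    pulled to the apex and pushed to the other end; spans with a leg that is not
    surjective act by zero. *)
Definition bracket a k (u : 'I_a -> 'I_r * 'I_k) : M k :=
  match pselect (surj_fun (fst \o u)), pselect (surj_fun (snd \o u)) with
  | left p, left s => low M (Surj s) (up M (pos_osurj (Surj p)) y)
  | _, _ => 0
  end.

Definition wbracket k (w : seq ('I_r * 'I_k)) : M k := bracket (tnth (in_tuple w)).

Lemma bracket_surj a k (u : 'I_a -> 'I_r * 'I_k) (p : surj_fun (fst \o u)) (s : surj_fun (snd \o u)) :
  bracket u = low M (Surj s) (up M (pos_osurj (Surj p)) y).
Proof.
rewrite /bracket; case: pselect => // p'; case: pselect => // s'.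
by rewrite (Prop_irrelevance p' p) (Prop_irrelevance s' s).
Qed.

Lemma bracket_fst a k (u : 'I_a -> 'I_r * 'I_k) : ~ surj_fun (fst \o u) -> bracket u = 0.
Proof. by rewrite /bracket; case: pselect. Qed.

Lemma bracket_snd a k (u : 'I_a -> 'I_r * 'I_k) : ~ surj_fun (snd \o u) -> bracket u = 0.
Proof. by rewrite /bracket; case: pselect => //; case: pselect. Qed.

(** The index type of a word is the ordinal of its length; this allows any equal
    length in its place. *)
Lemma wbracket_map a k (u : 'I_a -> 'I_r * 'I_k) : wbracket (map u (enum 'I_a)) = bracket u.
Proof.
have gen_a w (aw : size w = a) : (forall i, tnth (in_tuple w) i = u (cast_ord aw i)) ->
    wbracket w = bracket u.
  rewrite /wbracket; case: a / aw u => u E; congr bracket; apply/funext => i.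
  by rewrite E cast_ord_id.
have sz : size (map u (enum 'I_a)) = a by rewrite size_map size_enum_ord.
apply: (gen_a _ sz) => i; rewrite (tnth_nth (u (cast_ord sz i))) /=.
rewrite (nth_map (cast_ord sz i)) ?size_enum_ord; last exact: (ltn_ord (cast_ord sz i)).
by congr u; exact: (nth_ord_enum _ (cast_ord sz i)).
Qed.

Lemma wbracket_fst k (w : seq ('I_r * 'I_k)) j : j \notin map fst w -> wbracket w = 0.
Proof.
move=> jw; apply: bracket_fst => /(_ j)[i ij]; move/negP: jw; apply.
by rewrite -ij /= map_f // mem_tnth.
Qed.

Lemma wbracket_snd k (w : seq ('I_r * 'I_k)) j : j \notin map snd w -> wbracket w = 0.
Proof.
move=> jw; apply: bracket_snd => /(_ j)[i ij]; move/negP: jw; apply.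
by rewrite -ij /= map_f // mem_tnth.
Qed.

Lemma wbracket_low n k : (forall m, (n < m)%N -> ab_zero (M m)) ->
  low_degree n (@wbracket k).
Proof.
move=> Mn w nw; rewrite /wbracket /bracket.
case: pselect => // p; case: pselect => // s.
by rewrite (Mn _ nw (up _ _ _)) raddf0.
Qed.

Lemma low_bracket a k m (u : 'I_a -> 'I_r * 'I_k) (f : surj k m) : surj_fun (snd \o u) ->
  low M f (bracket u) = bracket (fun i => ((u i).1, f (u i).2)).
Proof.
move=> s; have [p|np] := pselect (surj_fun (fst \o u)); last first.
  by rewrite !bracket_fst ?raddf0.
have s' : surj_fun (snd \o (fun i => ((u i).1, f (u i).2))).
  by move=> z; have [x <-] := sfunP f z; have [i <-] := s x; exists i.
rewrite (bracket_surj p s) (bracket_surj (p : surj_fun (fst \o (fun i => ((u i).1, f (u i).2)))) s').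
have -> : Surj s' = surj_comp f (Surj s) by exact: surj_eq.
by rewrite /low (fmapM (jlow M) (f : @hom Omega _ _) (Surj s : @hom Omega _ _)).
Qed.

End Brackets.

Lemma enum_val_le a (A : {set 'I_a}) (i j : 'I_#|A|) :
  (enum_val i <= enum_val j)%N = (i <= j)%N.
Proof.
have mono (x z : 'I_#|A|) : (x <= z)%N -> (enum_val x <= enum_val z)%N.
  move=> xz; rewrite (enum_val_nth (enum_val x) x) (enum_val_nth (enum_val x) z).
  have sA : sorted (relpre (@nat_of_ord a) leq) (enum A).
    apply: (subseq_sorted (leT := relpre (@nat_of_ord a) leq)) (_ : subseq _ (enum 'I_a)) _.
    - by move=> ? ? ?; exact: leq_trans.
    - by rewrite [enum 'I_a]enumT [enum A]/enum_mem filter_subseq.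
    - by rewrite -sorted_map val_enum_ord iota_sorted.
  have rt : transitive (relpre (@nat_of_ord a) leq) by move=> ? ? ?; exact: leq_trans.
  have rr : reflexive (relpre (@nat_of_ord a) leq) by move=> ?; exact: leqnn.
  by apply: (sorted_leq_nth rt rr (enum_val x) sA); rewrite ?inE -?cardE.
apply/idP/idP => [ij|/mono//]; rewrite leqNgt; apply/negP => ji.
suff e : i = j by rewrite e ltnn in ji.
by apply: enum_val_inj; apply: val_inj; apply/eqP; rewrite eqn_leq ij mono // ltnW.
Qed.

Section UpBracket.
Variables (M : janus) (Mpm : pseudo_mackey M) (r : nat) (y : M r).
Variables (n m : nat) (phi : osurj n m).

Definition split_letter (l : 'I_r * 'I_m) : seq ('I_r * 'I_n) := [seq (l.1, i) | i <- ofibre phi l.2].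

Section Pullback.
Variables (c : nat) (V : 'I_c -> 'I_r * 'I_m).
Hypotheses (pS : surj_fun (fst \o V)) (gS : surj_fun (snd \o V)).

(** The pullback of the second leg of [V] and [phi].  In lexicographic order the order
    of positions restricts to that of [phi] on the fibres over ['I_c], and
    is compatible with the order of ['I_c]. *)
Definition plist : seq ('I_c * ('I_r * 'I_n)) :=
  flatten [seq [seq (p, l) | l <- split_letter (V p)] | p <- enum 'I_c].

Lemma mem_plist x : (x \in plist) = (x.2.1 == (V x.1).1) && (phi x.2.2 == (V x.1).2).
Proof.
case: x => p [j i] /=; apply/flatten_mapP/andP => [[p' _ /mapP[_ /mapP[i' i'f ->] [-> -> ->]]]|].
  by rewrite eqxx -mem_ofibre.
case=> /eqP-> fi; exists p; first by rewrite mem_enum.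
by apply: map_f; apply: map_f; rewrite mem_ofibre.
Qed.

Definition plex (x x' : 'I_c * ('I_r * 'I_n)) : bool :=
  (x.1 < x'.1)%N || ((x.1 == x'.1) && ole phi x.2.2 x'.2.2).

Lemma plex_trans : transitive plex.
Proof.
move=> b a d /orP[ab|/andP[/eqP ab oab]] /orP[bd|/andP[/eqP bd obd]]; rewrite /plex.
- by rewrite (ltn_trans ab bd).
- by rewrite -bd ab.
- by rewrite ab bd.
- by rewrite ab bd eqxx (fo_trans (oleP phi) oab obd) orbT.
Qed.

Lemma sorted_plist : sorted plex plist.
Proof.
apply: (@sorted_flatten _ _ _ _ _ (fun p p' : 'I_c => (p < p')%N)) => [p| |p p' a b pp'|].
- rewrite /split_letter -map_comp sorted_map.
  apply: sub_sorted (sorted_ofibre phi (V p).2) => i i' /= o.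
  by rewrite /plex /= eqxx o orbT.
- exact: plex_trans.
- by move=> /mapP[l _ ->] /mapP[l' _ ->]; rewrite /plex /= pp'.
rewrite -sorted_pairwise; last by move=> ? ? ?; exact: ltn_trans.
by rewrite -(@sorted_map _ _ (@nat_of_ord c) ltn) val_enum_ord iota_ltn_sorted.
Qed.

Lemma uniq_plist : uniq plist.
Proof.
rewrite /plist; elim: (enum 'I_c) (enum_uniq 'I_c) => //= p s IH /andP[ps us].
rewrite cat_uniq IH // andbT map_inj_uniq; last by move=> ? ? [].
rewrite map_inj_uniq ?uniq_ofibre /=; last by move=> ? ? [].
apply/hasPn => _ /flatten_mapP[p' p's /mapP[l _ ->]]; apply/negP => /mapP[l' _ [pp' _]].
by rewrite -pp' p's in ps.
Qed.

Local Notation N := (size plist).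
Definition pnth : 'I_N -> 'I_c * ('I_r * 'I_n) := tnth (in_tuple plist).

Lemma pnth_inj : injective pnth.
Proof. exact/tuple_uniqP/uniq_plist. Qed.

Lemma pnthP x : (pnth x).2.1 = (V (pnth x).1).1 /\ phi (pnth x).2.2 = (V (pnth x).1).2.
Proof.
have : pnth x \in plist by exact: mem_tnth.
by rewrite mem_plist => /andP[/eqP-> /eqP->].
Qed.

Lemma pnth_ex p i : phi i = (V p).2 -> exists x, pnth x = (p, ((V p).1, i)).
Proof.
move=> e; have /tnthP[x ->] : (p, ((V p).1, i)) \in in_tuple plist by rewrite mem_plist /= e !eqxx.
by exists x.
Qed.

Lemma pnth_le (x x' : 'I_N) : (x <= x')%N -> plex (pnth x) (pnth x').
Proof.
move=> xx'; have x0 := pnth x.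
have plex_refl : reflexive plex by move=> z; rewrite /plex eqxx (fo_refl (oleP phi)) orbT.
have := sorted_leq_nth plex_trans plex_refl x0 sorted_plist.
move=> /(_ x x'); rewrite !inE -!(tnth_nth x0 (in_tuple plist)); apply => //; exact: ltn_ord.
Qed.

Lemma bottom_leg_surj : surj_fun (fun x => (pnth x).2.2).
Proof.
move=> i; have [p pi] := gS (phi i).
by have [x ex] := pnth_ex (esym pi); exists x; rewrite ex.
Qed.

Lemma left_leg_surj : surj_fun (fun x => (pnth x).1).
Proof.
move=> p; have [i ip] := sfunP phi (V p).2.
by have [x ex] := pnth_ex ip; exists x; rewrite ex.
Qed.

Definition top : surj N n := Surj bottom_leg_surj.
Definition left_leg : osurj N c := pos_osurj (Surj left_leg_surj).

(** Along a fibre of the left leg, positions are ordered as [phi] orders the images: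
    that is what the lexicographic listing is for. *)
Lemma plist_square : square top (Surj gS) left_leg phi.
Proof.
split=> [x|i p e|x x' e] /=.
- exact: (proj2 (pnthP x)).
- have [x ex] := pnth_ex e; exists x; split=> [|x' [/= ei ep]]; first by rewrite /= ex.
  apply: pnth_inj; rewrite ex [RHS]surjective_pairing [(pnth x').2]surjective_pairing.
  by rewrite (proj1 (pnthP x')) ep ei.
have {}e : (pnth x).1 = (pnth x').1 by exact: e.
rewrite /pos_le /= e eqxx /=; apply/idP/idP => [/pnth_le|o].
  by rewrite /plex e ltnn eqxx.
rewrite leqNgt; apply/negP => x'x; have := pnth_le (ltnW x'x).
rewrite /plex e ltnn eqxx /= => o'.
have ei : (pnth x).2.2 = (pnth x').2.2 by apply: (fo_anti (oleP phi)); rewrite o o'.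
have xx' : x = x'.
  apply: pnth_inj; rewrite [LHS]surjective_pairing [(pnth x).2]surjective_pairing.
  rewrite (proj1 (pnthP x)) ei e -(proj1 (pnthP x')).
  by rewrite -surjective_pairing -surjective_pairing.
by rewrite xx' ltnn in x'x.
Qed.

(** The pseudo-Mackey relation for [plist_square].  Each term is again a bracket,
    since the composite of two orders of positions is the order of positions. *)
Lemma up_bracket_sum : up M phi (bracket y V) =
  \sum_(A : {set 'I_N} | admissible top left_leg A)
     bracket y (fun i : 'I_#|A| => (pnth (enum_val i)).2).
Proof.
rewrite (bracket_surj y pS gS) (pm_square Mpm plist_square).
rewrite (big_sub (fun A => admissible top left_leg A)); apply: eq_bigr => A _.
have [sS lS] := asboolW (valP A).
have pA : surj_fun (fst \o (fun i : 'I_#|val A| => (pnth (enum_val i)).2)).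
  move=> j; have [p <-] := pS j; have [i <-] := lS p; exists i.
  exact: (proj1 (pnthP _)).
rewrite (bracket_surj y pA sS) (_ : Surj sS = surj_restr A); last exact: surj_eq.
congr (low M _ _).
have -> : pos_osurj (Surj pA) = osurj_comp (pos_osurj (Surj pS)) (osurj_restr A).
  apply: osurj_eq => [i|i j] /=; first exact: (proj1 (pnthP _)).
  rewrite /ole_comp /= /pos_le /= /restr /=.
  rewrite !(proj1 (pnthP _)) enum_val_le; have [pij|pij] := eqVneq (pnth (enum_val i)).1 (pnth (enum_val j)).1.
    by rewrite pij eqxx.
  congr (_ && _); apply/idP/idP => [ij|pl].
    have := pnth_le (_ : enum_val i <= enum_val j)%N; rewrite enum_val_le => /(_ ij).
    by rewrite /plex => /orP[/ltnW //|/andP[/eqP->]].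
  rewrite leqNgt; apply/negP => /ltnW ji.
  have := pnth_le (_ : enum_val j <= enum_val i)%N; rewrite enum_val_le => /(_ ji).
  by rewrite /plex eq_sym (negPf pij) orbF ltnNge pl.
by rewrite /up (fmapM (jup M) (osurj_restr A : @hom (op OmegaAs) _ _)
  (pos_osurj (Surj pS) : @hom (op OmegaAs) _ _)).
Qed.

End Pullback.

(** Choosing nonempty sublists in the blocks of [v] amounts to choosing a subset of the
    pullback that surjects onto the positions of [v], that is half of the admissibility
    condition; where the other half fails the bracket is zero. *)
Lemma up_wbracket v :
  up M phi (wbracket y v) = blocks split_letter v (wbracket y (k := n)).
Proof.
have mem_split (x : 'I_r * 'I_n) : x \in flatten (map split_letter v) -> (x.1, phi x.2) \in v.
  case/flatten_mapP => l lv /mapP[i]; rewrite mem_ofibre => /eqP il -> /=.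
  by rewrite il -surjective_pairing.
pose V := tnth (in_tuple v).
have Vv l : l \in v -> exists i, V i = l.
  by move=> lv; have /tnthP[i li] : l \in in_tuple v by []; exists i.
have [pS|] := pselect (surj_fun (fst \o V)); last first.
  move=> np; rewrite {1}/wbracket bracket_fst // raddf0; apply/esym/blocks_eq0 => u su _.
  move/existsNP: np => [j nj]; apply: (@wbracket_fst _ _ _ _ _ j); apply/mapP => -[x /su/mem_split xv jx].
  by have [a Va] := Vv _ xv; apply: nj; exists a; rewrite /= Va.
have [gS|] := pselect (surj_fun (snd \o V)); last first.
  move=> np; rewrite {1}/wbracket bracket_snd // raddf0; apply/esym/blocks_eq0 => u su _.
  move/existsNP: np => [j nj]; have [i ij] := sfunP phi j.
  apply: (@wbracket_snd _ _ _ _ _ i); apply/mapP => -[x /su/mem_split xv jx].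
  by have [a Va] := Vv _ xv; apply: nj; exists a; rewrite /= Va -ij jx.
rewrite {1}/wbracket (up_bracket_sum pS gS).
pose zz := [seq (p, V p) | p <- enum 'I_(size v)].
have zz1 : map fst zz = enum 'I_(size v) by rewrite -map_comp map_id_in.
have -> : blocks split_letter v (wbracket y (k := n)) =
    blocks split_letter (map snd zz) (wbracket y (k := n)).
  by rewrite -map_comp -[in LHS](map_tnth_enum v).
rewrite blocks_labelled zz1 ?enum_uniq //.
rewrite (_ : flatten _ = plist V); last by rewrite /plist /zz -map_comp.
rewrite -[in RHS](map_tnth_enum (plist V)) subs_map big_map sum_subs_set.
rewrite big_mkcond; apply: eq_bigr => A _.
set W : seq _ := map _ (enum A).
have -> : map snd W = map (fun i => (pnth (V := V) (enum_val i)).2) (enum 'I_#|A|).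
  by rewrite /W enum_set_map -!map_comp.
rewrite wbracket_map.
have allP : all (mem (map fst W)) (enum 'I_(size v)) <-> surj_fun (restr (left_leg V) A).
  split=> [/allP aW p|lS]; last first.
    apply/allP => p _; have [i <-] := lS p; rewrite /W -map_comp /=.
    by apply/mapP; exists (enum_val i); rewrite // mem_enum enum_valP.
  have := aW p; rewrite mem_enum => /(_ isT); rewrite /W -map_comp => /mapP[x]; rewrite mem_enum => xA px.
  by exists (enum_rank_in xA x); rewrite /restr enum_rankK_in.
rewrite /admissible; case: asboolP => [[_ /allP->]//|nadm].
case: ifP => // /allP lS; rewrite bracket_snd // => tS; apply: nadm.
by split=> // i; have [x xi] := tS i; exists x.
Qed.

End UpBracket.

Lemma Delta_indicator (T : finType) (A : zmodType) (t : seq T) (c : A) :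
  Delta (enum T) (fun u => if all (mem u) t then c else 0) =
  if all (mem t) (enum T) then c else 0.
Proof.
case: allP => [Tt|nTt].
  rewrite Delta_top; first by case: allP => // -[] x _; rewrite inE mem_enum.
  move=> u su /(subseq_enum_missing su)[i iu]; case: allP => // ut.
  by have := ut i (Tt i _); rewrite /= (negPf iu) mem_enum => /(_ isT).
have [i it] : exists i, i \notin t.
  apply: contrapT => /forallNP nt; apply: nTt => i _ /=.
  by have := nt i; case: (i \in t).
apply: (@Delta_indep _ _ i); first by rewrite mem_enum.
move=> u; congr (if _ then _ else _); apply: eq_in_all => j jt /=.
by rewrite mem_filter /= (memPn it).
Qed.

(** Postcomposition acts on a tuple entry by entry, hence letter by letter on the
    element of the free group on pairs that encodes it. *)
Lemma flat_comp (r k m : nat) (h : FG 'I_r ~> FG 'I_k) (u : FG 'I_k ~> FG 'I_m)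
    (u' : FG ('I_r * 'I_k)%type ~> FG ('I_r * 'I_m)%type) :
  (forall j i, pm (fun i => Some (j, i) : option ('I_r * 'I_m)) (u (gen i)) = u' (gen (j, i))) ->
  flat (u \oo h) = u' (flat h).
Proof.
move=> E; rewrite /flat gmulf_prod; apply: eq_bigr => j _; rewrite gcompE.
have K : pm (fun i => Some (j, i) : option ('I_r * 'I_m)) \oo u =
    u' \oo pm (fun i => Some (j, i) : option ('I_r * 'I_k)).
  by apply: free_eq => i; rewrite !gcompE E pm_gen.
exact: (congr1 (fun v : FG 'I_k ~> FG ('I_r * 'I_m)%type => v (h (gen j))) K).
Qed.

Section CounitSurjective.
Variables (n : nat) (M : janus) (Mpm : pseudo_mackey M).
Hypothesis Mn : forall m, (n < m)%N -> ab_zero (M m).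
Variables (r : nat) (y : M r).

(** The element of [Psi M (FG 'I_r)] whose value at the identity is [y]: the sum of
    the brackets of all words, weighted by the coefficients of the Magnus expansion
    of the coordinates of [h]. *)
Definition bracket_fam : fam M (FG 'I_r) :=
  fun k h => magnus n (flat h) (wbracket y (k := k)) [::].

Lemma bracket_natural : natural_fam bracket_fam.
Proof.
have W k := @wbracket_low M r y n k Mn.
have flat_pm k m (f : 'I_k -> option 'I_m) (h : FG 'I_r ~> FG 'I_k) :
    bracket_fam (pm f \oo h) =
    magnus n (flat h) (pull (fun l : 'I_r * 'I_k => omap (pair l.1) (f l.2)) (wbracket y (k := m))) [::].
  rewrite /bracket_fam -magnus_pm //; congr (magnus _ _ _ _).
  apply: flat_comp => j i; rewrite !pm_gen /=.
  by case: (f i) => [i'|] /=; rewrite ?pm_gen ?gmulf1.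
split=> [m i h hi|a m phi h|a m f h].
- rewrite -hi flat_pm (_ : pull _ _ = fun=> 0) ?magnus0 //; apply/funext => w.
  rewrite /pull; case: ifP => // _; apply: (@wbracket_snd _ _ _ _ _ i).
  elim: w => //= l w IH; rewrite /on mem_others; case: eqP => //= li.
  by rewrite inE negb_or IH andbT eq_sym; apply/eqP.
- rewrite /bracket_fam (@flat_comp _ _ _ _ _ (word_hom (split_letter phi))); last first.
    move=> j i; rewrite comul_gen pm_gword lift_gen; congr gword.
  rewrite magnus_word_hom; last exact: W.
  rewrite [RHS](magnus_raddf (up M phi) (flat h) (@W m)); congr (magnus _ _ _ _).
  by apply/funext => w; rewrite up_wbracket.
rewrite /bracket_fam [LHS](magnus_raddf (low M f) (flat h) (@W a)).
rewrite (_ : Delta _ _ = Delta (enum 'I_a) (fun u => magnus n (flat h)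
    (pull (fun l : 'I_r * 'I_a => omap (pair l.1) (on u f l.2)) (wbracket y (k := m))) [::])); last first.
  by apply: Delta_eq => u _; rewrite -flat_pm.
have := magnus_Delta n (flat h) (enum 'I_a) (fun u =>
  pull (fun l : 'I_r * 'I_a => omap (pair l.1) (on u f l.2)) (wbracket y (k := m))).
move=> /(congr1 (fun e => e [::])) <-; congr (magnus _ _ _ _); apply/funext => w.
transitivity (if all (mem (map snd w)) (enum 'I_a)
    then wbracket y (map (fun l => (l.1, f l.2)) w) else 0); last first.
  rewrite -Delta_indicator; apply: Delta_eq => u _; rewrite /pull.
  have -> : all (mem u) (map snd w) =
      all (fun l : 'I_r * 'I_a => omap (pair l.1) (on u f l.2) : bool) w.
    by rewrite all_map; apply: eq_all => l /=; rewrite /on; case: ifP.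
  case: ifP => // aw; congr wbracket; elim: w aw => //= l w IH.
  by move: IH; rewrite /on; case: ifP => //= _ IH /IH ->.
case: allP => [aw|naw]; last first.
  have [i iw] : exists i, i \notin map snd w.
    apply: contrapT => /forallNP nt; apply: naw => i _ /=.
    by have := nt i; case: (i \in _).
  by rewrite (wbracket_snd _ iw) raddf0.
have -> : map (fun l => (l.1, f l.2)) w =
    map (fun i => ((tnth (in_tuple w) i).1, f (tnth (in_tuple w) i).2)) (enum 'I_(size w)).
  by rewrite -[in LHS](map_tnth_enum w) -map_comp.
rewrite wbracket_map -low_bracket // => i.
have /aw /= /mapP[l lw ->] : i \in enum 'I_a by rewrite mem_enum.
by have /tnthP[x ->] : l \in in_tuple w by []; exists x.
Qed.

Definition bracket_nfam : nfam M (FG 'I_r) := nfam_mk bracket_natural.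

Lemma bracket_cross : cross (F := Psi_fun M) bracket_nfam.
Proof.
move=> j; apply: ev_eq => k h; rewrite ev_act raddf0 ev_mk /bracket_fam.
have -> : flat (h \oo fkill (others j)) =
    pm (fun l : 'I_r * 'I_k => if l.1 != j then Some l else None) (flat h).
  rewrite /flat gmulf_prod; apply: eq_bigr => i _.
  rewrite gcompE pm_gen /on mem_others pm_compE /=.
  case: (i != j) => //=; rewrite !gmulf1 (_ : pm _ = one_fun _ :> {ghom _ -> _}) //.
  by apply: free_eq => l; rewrite pm_gen.
rewrite magnus_pm; last exact: wbracket_low.
rewrite (_ : pull _ _ = fun=> 0) ?magnus0 //; apply/funext => w.
rewrite /pull; case: ifP => // _; apply: (@wbracket_fst _ _ _ _ _ j).
elim: w => //= l w IH; case: eqP => //= lj.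
by rewrite inE negb_or IH andbT eq_sym; apply/eqP.
Qed.

(** The identity is encoded by the word of the diagonal pairs, which is its only
    sublist with a surjective first leg. *)
Lemma bracket_id : ev (idfun : FG 'I_r ~> FG 'I_r) bracket_nfam = y.
Proof.
rewrite ev_mk /bracket_fam.
have -> : flat (idfun : FG 'I_r ~> FG 'I_r) = gword [seq (j, j) | j <- enum 'I_r].
  by rewrite /flat /gword [RHS]big_map; apply: eq_bigr => j _; rewrite /= pm_gen.
rewrite magnus_gword; last exact: wbracket_low.
set d := map _ _.
have ud : uniq d by rewrite map_inj_uniq ?enum_uniq // => i j [].
rewrite (bigD1_seq d) ?uniq_subs ?mem_subs //= [X in _ + X]big_seq_cond big1 ?addr0; last first.
  move=> c /andP[]; rewrite mem_subs cats0 => cd ncd.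
  have [j jc] : exists j, j \notin map fst c.
    have ed : map fst d = enum 'I_r by rewrite -map_comp map_id_in.
    apply: subseq_enum_missing; first by rewrite -ed map_subseq.
    apply: contraNneq ncd => ec; rewrite -(size_subseq_leqif cd).2.
    by rewrite -(size_map fst c) ec -ed size_map.
  exact: wbracket_fst jc.
rewrite cats0 wbracket_map.
have s1 : surj_fun (fst \o (fun j : 'I_r => (j, j))) by move=> j; exists j.
have s2 : surj_fun (snd \o (fun j : 'I_r => (j, j))) by move=> j; exists j.
rewrite (bracket_surj y s1 s2).
have -> : Surj s2 = surj_id r by exact: surj_eq.
have -> : pos_osurj (Surj s1) = osurj_id r.
  apply: osurj_eq => // i j /=; rewrite /pos_le /=.
  by case: eqP => // ->; rewrite leqnn.
by rewrite /low /up (fmap1 (jlow M) r) (fmap1 (jup M) r).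
Qed.

End CounitSurjective.

(** * The equivalence *)

Section Counit.
Variable M : janus.
Local Notation Psi_M := (Psi_fun M).

Lemma ev_id_act (X : gr) k (h : X ~> FG 'I_k) (th : nfam M X) :
  ev (idfun : FG 'I_k ~> FG 'I_k) (act Psi_M h th) = ev h th.
Proof. by rewrite ev_act; congr (ev _ th); exact: ghom_eq. Qed.

Lemma ev_cross k m (th : nfam M (FG 'I_k)) (h : FG 'I_k ~> FG 'I_m) i :
  cross (F := Psi_M) th -> h (gen i) = 1%g -> ev h th = 0.
Proof. by move=> cth hi; rewrite -ev_id_act (cross_kill cth hi) raddf0. Qed.

(** The discarded terms take values at morphisms that miss a generator. *)
Lemma ev_id_eps k (th : nfam M (FG 'I_k)) :
  ev (idfun : FG 'I_k ~> FG 'I_k) (eps Psi_M _ th) = ev (idfun : FG 'I_k ~> FG 'I_k) th.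
Proof.
rewrite epsE raddf_Delta Delta_top ?act_fkill_enum // => u su.
move=> /(subseq_enum_missing su)[i iu]; rewrite ev_id_act; apply: (@ev_kill _ _ _ _ i).
rewrite pm_on_comp; congr pm; apply: on_ext => j; rewrite mem_filter mem_others.
by case: eqP => [->|]; rewrite ?(negPf iu).
Qed.

Definition counit_fun k : {additive cr Psi_M k -> M k} :=
  ev (idfun : FG 'I_k ~> FG 'I_k) \o cr_val Psi_M k.

Lemma counit_low k m (f : surj k m) x :
  counit_fun m (low (cr_janus Psi_M) f x) = low M f (counit_fun k x).
Proof.
rewrite -[LHS]/(ev _ (act Psi_M (pm (Some \o f)) (cr_val _ _ x))) ev_id_act.
rewrite -[counit_fun k x]/(ev idfun (cr_val _ _ x)) ev_low Delta_top ?on_enum.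
  by congr (ev _ _); exact: ghom_eq.
move=> u su /(subseq_enum_missing su)[i iu]; apply: (@ev_cross _ _ _ _ i); first exact: cr_valP.
by rewrite gcompE pm_gen /on (negPf iu).
Qed.

Lemma counit_up k m (phi : osurj k m) x :
  counit_fun k (up (cr_janus Psi_M) phi x) = up M phi (counit_fun m x).
Proof.
rewrite -[LHS]/(ev idfun (eps _ _ (act Psi_M (comul phi) (cr_val _ _ x)))) ev_id_eps ev_id_act.
rewrite -[counit_fun m x]/(ev idfun (cr_val _ _ x)) -ev_up.
by congr (ev _ _); exact: ghom_eq.
Qed.

Definition counit : janus_hom (cr_janus Psi_M) M :=
  @JanusHom (cr_janus Psi_M) M counit_fun counit_low counit_up.

Lemma counit_bij n : pseudo_mackey M -> (forall m, (n < m)%N -> ab_zero (M m)) ->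
  forall k, is_bij (counit_fun k).
Proof.
move=> Mpm Mn k; split=> [|y].
  apply: zmod_inj0 => x x0; apply: cr_eq; apply: ev_eq => m h; rewrite !raddf0.
  exact: (ev_eq0 Mn (cr_valP x) x0).
by exists (subz_mk (@cross0 Psi_M _) (@crossB Psi_M _) (bracket_cross Mpm Mn y)); exact: bracket_id.
Qed.

End Counit.

Section Unit.
Variable F : functor gr Ab.

Definition cr_proj_fun m (y : (F (FG 'I_m) : zmodType)) : cr F m :=
  subz_mk (@cross0 F _) (@crossB F _) (eps_cross y).

Lemma cr_proj_zmod m : zmod_morphism (@cr_proj_fun m).
Proof.
move=> x y; apply: cr_eq; rewrite [RHS]raddfB.
exact: (raddfB (eps F 'I_m)).
Qed.

HB.instance Definition _ m := GRing.isZmodMorphism.Build _ _ (@cr_proj_fun m) (@cr_proj_zmod m).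

Definition cr_proj m : {additive (F (FG 'I_m) : zmodType) -> cr F m} := @cr_proj_fun m.

Lemma cr_projE m y : cr_val F m (cr_proj m y) = eps F _ y.
Proof. by []. Qed.

Lemma unit_natural (X : gr) (x : (F X : zmodType)) :
  natural_fam (M := cr_janus F) (X := X) (fun m h => cr_proj m (act F h x)).
Proof.
split=> [m i h hi|n m phi h|n m f h]; apply: cr_eq.
- by rewrite cr_projE raddf0; exact: eps_missing hi.
- by rewrite cr_projE act_gcomp -eps_comul.
rewrite raddf_Delta -[LHS]/(act F (pm (Some \o f)) (eps F _ (act F h x))).
rewrite -[LHS]eps_id; last by apply: cross_pm; [exact: sfunP | exact: eps_cross].
rewrite (epsE (act F h x)) !raddf_Delta; apply: Delta_eq => u _.
rewrite cr_projE -!act_gcomp gcompA pm_comp; congr (eps F _ (act F (_ \oo _) x)).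
by apply: pm_ext => i; rewrite /on; case: ifP.
Qed.

Definition unit_fun (X : gr) (x : (F X : zmodType)) : nfam (cr_janus F) X :=
  nfam_mk (unit_natural x).

Lemma ev_unit_fun (X : gr) (x : (F X : zmodType)) m (h : X ~> FG 'I_m) :
  ev h (unit_fun x) = cr_proj m (act F h x).
Proof. by []. Qed.

Lemma unit_zmod X : zmod_morphism (@unit_fun X).
Proof.
move=> x y; apply: ev_eq => m h; rewrite [RHS]raddfB !ev_unit_fun.
by rewrite raddfB [LHS]raddfB.
Qed.

HB.instance Definition _ X := GRing.isZmodMorphism.Build _ _ (@unit_fun X) (@unit_zmod X).

Definition unit_map (X : gr) : {additive (F X : zmodType) -> nfam (cr_janus F) X} := @unit_fun X.

Lemma unit_nat (X Y : gr) (f : @hom gr X Y) :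
  cmp (unit_map Y : @hom Ab _ _) (fmap (fmor F) f) =
  cmp (fmap (fmor (Psi_fun (cr_janus F))) f) (unit_map X : @hom Ab _ _).
Proof.
apply: additive_eq => x; apply: ev_eq => m h.
rewrite -[RHS]/(cr_proj m (act F (h \oo f) x)) -[LHS]/(cr_proj m (act F h (act F f x))).
by rewrite act_gcomp.
Qed.

Definition unit_trans : nat_trans F (Psi_fun (cr_janus F)) :=
  @NatTrans gr Ab F (Psi_fun (cr_janus F)) (fun X => unit_map X) unit_nat.

(** A triangle identity: the cross-effects of the unit are inverse to the counit. *)
Lemma counit_unit k x : counit_fun (cr_janus F) k (cr_map unit_trans k x) = x.
Proof.
apply: cr_eq; rewrite -[LHS]/(eps F _ (act F idfun (cr_val F k x))) act_id eps_id //.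
exact: cr_valP.
Qed.

End Unit.

Lemma section_bij (A B : Type) (f : A -> B) (g : B -> A) :
  (forall x, g (f x) = x) -> is_bij g -> is_bij f.
Proof.
move=> gf [gI gS]; split=> [|y]; first exact: can_inj gf.
by exists (g y); apply: gI; rewrite gf.
Qed.

Theorem theorem0p3 (n : nat) : equivalent_categories (Pol n) (PMack_le n).
Proof.
exists (Phi n), (Psi n); split.
- have unitN (F G : Pol n) (a : hom F G) :
    cmp (unit_trans (sval G) : @hom (Pol n) G (Psi n (Phi n G))) (fmap (fmor (functor_id (Pol n))) a) =
    cmp (fmap (fmor (functor_comp (Psi n) (Phi n))) a)
      (unit_trans (sval F) : @hom (Pol n) F (Psi n (Phi n F))).
    apply: nat_trans_eq => X; apply: additive_eq => x; apply: ev_eq => m h; apply: cr_eq.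
    rewrite -[LHS]/(eps (sval G) _ (act (sval G) h (nt_app a X x))).
    by rewrite -[RHS]/(nt_app a _ (eps (sval F) _ (act (sval F) h x))) nt_eps nt_act.
  exists (@NatTrans _ _ (functor_id (Pol n)) (functor_comp (Psi n) (Phi n))
    (fun F => unit_trans (sval F)) unitN).
  apply: nat_trans_iso => F /=; apply: Phi_reflects_iso => m.
  apply: (section_bij (@counit_unit (sval F) m)).
  exact: (counit_bij (cr_pseudo_mackey _) (proj2 (svalP (Phi n F)))).
have counitN (M N : PMack_le n) (s : hom M N) :
  cmp (counit (sval (sval N)) : @hom (PMack_le n) (Phi n (Psi n N)) N)
    (fmap (fmor (functor_comp (Phi n) (Psi n))) s) =
  cmp (fmap (fmor (functor_id (PMack_le n))) s)
    (counit (sval (sval M)) : @hom (PMack_le n) (Phi n (Psi n M)) M).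
  by apply: janus_hom_eq => k x.
exists (@NatTrans _ _ (functor_comp (Phi n) (Psi n)) (functor_id (PMack_le n))
  (fun M => counit (sval (sval M))) counitN).
apply: nat_trans_iso => M /=; apply: janus_iso => k.
exact: (counit_bij (svalP (sval M)) (proj2 (svalP M))).
Qed.
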